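(* Let $\Gamma$ be an arbitrary convex lattice configuration contained in an apartment of $\mathfrak B_d$, and let $0<r<d$. Then the generalized Bruhat order on $LG_r(\Gamma)$ (that is, on the Bruhat strata of its special fiber $LG_r(\Gamma)_0$) is the same as the rank-vector order.
   Context: SETTING. $R$ is a discrete valuation ring with fraction field $K$, uniformizer $\pi$ and algebraically closed residue field $\kappa$; $0<r<d$ are integers. A lattice in $K^d$ is a free $R$-submodule $L\subset K^d$ with $L\otimes_RK\to K^d$ an isomorphism; $[L]$ is its homothety class. Distinct classes are adjacent if they have representatives with $\pi L_1\subset L_2\subset L_1$; $\mathfrak B_d$ is the flag complex of homothety classes under adjacency. A convex lattice configuration is a finite nonempty set $\Gamma$ of classes such that $[L_1\cap L_2]\in\Gamma$ for any representatives $L_1,L_2$ of two members of $\Gamma$. It is contained in an apartment if there is a basis $e_1,\dots,e_d$ of $K^d$ such that all its classes have the form $[\langle\pi^{c_1}e_1,\dots,\pi^{c_d}e_d\rangle]$. Write $\Gamma=\{[L_v]\}_v$ with fixed representatives and identify $\Gamma$ with the index set. For $u,v\in\Gamma$ let $n_{u,v}$ be the minimal integer with $\pi^{n_{u,v}}L_u\subset L_v$, put $\overline L_v=L_v/\pi L_v$, and let $f_{u,v}:\overline L_u\to\overline L_v$ be induced by multiplication by $\pi^{n_{u,v}}$. LINKED GRASSMANNIAN AND RANK VECTORS. $LG_r(\Gamma)$ is the projective $R$-scheme whose $T$-points are collections of rank-$r$ sub-bundles $E_v\subset L_v\otimes\mathcal O_T$ such that for every inclusion $\pi^k:L_u\hookrightarrow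 L_v$ ($k\in\mathbb Z$) the induced map sends $E_u$ into $E_v$. The points of its special fiber $LG_r(\Gamma)_0$ are the families $(U_v)_v$ of $r$-dimensional subspaces $U_v\subset\overline L_v$ with $f_{u,v}(U_u)\subset U_v$ for all $u,v$. The rank vector of $(U_v)_v$ is $(\dim f_{u,v}(U_u))_{u,v\in\Gamma}$. The rank-vector strata are the sets of points with given rank vector, and the rank-vector order on them is the coordinatewise order $\le$ of rank vectors. The rank-vector stratification coincides with the Bruhat stratification defined next (the rank vector is constant on each $S_{\mathbf x}$, and different strata have different rank vectors), so both orders are orders on the same strata. BRUHAT STRATIFICATION. For $a\in\mathbb Z^d$ put $L(a)=\langle\pi^{-a(1)}e_1,\dots,\pi^{-a(d)}e_d\rangle$. $\widetilde W=\mathbb S_d\ltimes\mathbb Z^d$ acts on $\mathbb Z^d$ by $(\sigma,v)\cdot a=(a(\sigma^{-1}(1)),\dots,a(\sigma^{-1}(d)))+v$, with group law $(\sigma_1,v_1)(\sigma_2,v_2)=(\sigma_2\sigma_1,v_1+\sigma_1\cdot v_2)$, where $\sigma_2\sigma_1$ means first $\sigma_2$, then $\sigma_1$ (so the group law is composition of transformations); $W_a\subset\widetilde W$ consists of the elements with $\sum_kv(k)=0$. Put $\omega_i=(1^i,0^{d-i})$ and $\omega_I=(\omega_i)_{i\in I}$ for $I\subset\{0,\dots,d-1\}$. Let $\tau_j$ $(j\in\mathcal J)$ be the maximal simplices of the complex spanned by $\Gamma$ (maximal sets of pairwise adjacent classes). Choose representatives $L_v=L(a_v)$ such that those of the vertices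 of each $\tau_j$ can be ordered as $L_0\subset L_1\subset\dots\subset\pi^{-1}L_0$; then $(a_v)_{v\in\tau_j}=g_j\cdot\omega_{I_j}$ for some $g_j\in\widetilde W$ and some $I_j$. Let $W_j$ (resp. $W_{j,j'}$) be the subgroup of $W_a$ fixing $a_v$ for all $v\in\tau_j$ (resp. $v\in\tau_j\cap\tau_{j'}$). $\mathbf{adm}_r(\Gamma)$ is the set of tuples $\mathbf x=(h_jW_j)_{j\in\mathcal J}$, $h_j\in\widetilde W$, with $a_v\le h_j\cdot a_v\le a_v+(1,\dots,1)$ coordinatewise and $\sum_k (h_j\cdot a_v)(k)-\sum_k a_v(k)=r$ for $v\in\tau_j$, and $W_{j,j'}h_jW_{j,j'}=W_{j,j'}h_{j'}W_{j,j'}$ for all $j,j'$. For $a\in\mathbb Z^d$ let $\Lambda(a)=\langle t^{-a(1)}e_1,\dots,t^{-a(d)}e_d\rangle_{\kappa[[t]]}\subset\kappa((t))^d$; identify $\overline L_v$ with $\Lambda(a_v)/t\Lambda(a_v)$ by sending the class of $\pi^{-a_v(k)}e_k$ to that of $t^{-a_v(k)}e_k$. Let $P_j\subset\mathrm{SL}_d(\kappa((t)))$ be the common stabilizer of the $\Lambda(a_v)$, $v\in\tau_j$. The Bruhat stratum $S_{\mathbf x}$ (a fiber product of Schubert cells) is the set of points $(E_v)_v$ of $LG_r(\Gamma)_0$ such that for each $j$ the tuple $(t^{-1}\widetilde E_v)_{v\in\tau_j}$ lies in the $P_j$-orbit of $(\Lambda(h_j\cdot a_v))_{v\in\tau_j}$,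 where $\widetilde E_v\subset\Lambda(a_v)$ is the preimage of $E_v$. $S_{\mathbf x}$ depends only on the double cosets $(W_jh_jW_j)_j$. GENERALIZED BRUHAT ORDER (on $\mathbf{adm}_r(\Gamma)$, the index set of the Bruhat strata). $W_a$ is a Coxeter group with generators $s_0=((1\,d),(1,0,\dots,0,-1))$, $s_i=((i\ i{+}1),0)$, $1\le i\le d-1$, with its length function and Bruhat order. Let $\iota=((12\cdots d),(1,0^{d-1}))$. Let $F_j$ be the face whose vertices are represented by $(\iota^rg_j)\cdot\omega_{I_j}$, and let $W_{F_j}\subset W_a$ be the subgroup fixing its vertices. For $\mathbf x=(h_jW_j)_j$ and $\mathbf y=(h'_jW_j)_j$: $\mathbf x\preceq\mathbf y$ iff $W_j(h_j\iota^{-r})W_{F_j}\preceq_jW_j(h'_j\iota^{-r})W_{F_j}$ for all $j\in\mathcal J$, where $\preceq_j$ is the Bruhat order on $W_j\backslash W_a/W_{F_j}$, i.e. the order induced by the Bruhat order of $W_a$ when a double coset $W_jwW_{F_j}$ is identified with its representative, the unique element of maximal length in $\{(uw)^{F_j}\mid u\in W_j\}$, with $x^{F_j}$ the unique element of minimal length in $xW_{F_j}$.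
   Formalization: For each j the Bruhat order is taken for generators g_j s_i g_j^{-1}, with ι replaced by g_j ι g_j^{-1} (also in F_j); with the fixed s_i and ι the claim fails, e.g. d=2, r=1, Γ={[L(1,0)],[L(2,0)]}, where the rank-minimal stratum is Bruhat-maximal. *)

(* Defs.v *)
From HB Require Import structures.
From mathcomp Require Import all_boot all_order all_fingroup all_algebra.
From mathcomp Require Import fraction.
From mathcomp Require Import boolp classical_sets cardinality.
From Stdlib Require Import Relation_Operators.

Set Implicit Arguments.
Unset Strict Implicit.
Unset Printing Implicit Defensive.

Import Order.TTheory GRing.Theory Num.Theory.

Local Open Scope classical_set_scope.
Local Open Scope ring_scope.

Notation tofrac := (@FracField.tofrac _).

(* Formal power series; k((t)) is {fraction {fps k}}. *)
Record fps (k : fieldType) := FPS { fps_coef :> nat -> k }.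
Notation "{ 'fps' k }" := (fps k) (format "{ 'fps'  k }") : type_scope.

HB.instance Definition _ (k : fieldType) := gen_eqMixin {fps k}.
HB.instance Definition _ (k : fieldType) := gen_choiceMixin {fps k}.

Section FpsRing.
Context {k : fieldType}.
Implicit Types f g h : {fps k}.

Lemma fpsP f g : (forall n, f n = g n) -> f = g.
Proof. by case: f => f; case: g => g /= fg; congr FPS; apply: funext. Qed.

Definition fps0 : {fps k} := FPS (fun=> 0).
Definition fps_opp f : {fps k} := FPS (fun n => - f n).
Definition fps_add f g : {fps k} := FPS (fun n => f n + g n).
Definition fps1 : {fps k} := FPS (fun n => (n == 0%N)%:R).
Definition fps_mul f g : {fps k} :=
  FPS (fun n => \sum_(i < n.+1) f i * g (n - i)%N).

Fact fps_addA : associative fps_add.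
Proof. by move=> f g h; apply: fpsP => n /=; rewrite addrA. Qed.
Fact fps_addC : commutative fps_add.
Proof. by move=> f g; apply: fpsP => n /=; rewrite addrC. Qed.
Fact fps_add0 : left_id fps0 fps_add.
Proof. by move=> f; apply: fpsP => n /=; rewrite add0r. Qed.
Fact fps_addN : left_inverse fps0 fps_opp fps_add.
Proof. by move=> f; apply: fpsP => n /=; rewrite addNr. Qed.

HB.instance Definition _ :=
  GRing.isZmodule.Build {fps k} fps_addA fps_addC fps_add0 fps_addN.

Let tr N f : {poly k} := \poly_(i < N) f i.

Let trM N f g n : (n < N)%N -> fps_mul f g n = (tr N f * tr N g)`_n.
Proof.
move=> nN; rewrite coefM /=; apply: eq_bigr => -[i /= iN] _.
rewrite !coef_poly !ifT //; last by apply: leq_trans iN _.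
by apply: leq_ltn_trans nN; rewrite leq_subr.
Qed.

Fact fps_mulC : commutative fps_mul.
Proof. by move=> f g; apply: fpsP => n; rewrite !(@trM n.+1) // mulrC. Qed.
Fact fps_mulA : associative fps_mul.
Proof.
move=> f g h; apply: fpsP => n.
transitivity (tr n.+1 f * tr n.+1 g * tr n.+1 h)`_n.
  rewrite -mulrA coefM -[LHS]/(\sum_(i < n.+1) f i * fps_mul g h (n - i)%N).
  apply: eq_bigr => -[i /= iN] _.
  by rewrite coef_poly iN -(@trM n.+1) // ltnS leq_subr.
rewrite coefM -[RHS]/(\sum_(i < n.+1) fps_mul f g i * h (n - i)%N).
apply: eq_bigr => -[i /= iN] _.
by rewrite [in LHS]coef_poly ltnS leq_subr -(@trM n.+1).
Qed.
Fact fps_mul1 : left_id fps1 fps_mul.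
Proof.
move=> f; apply: fpsP => n /=; rewrite big_ord_recl /= mul1r subn0.
by rewrite big1 ?addr0 // => i _; rewrite mul0r.
Qed.
Fact fps_mulDl : left_distributive fps_mul fps_add.
Proof.
move=> f g h; apply: fpsP => n /=; rewrite -big_split /=.
by apply: eq_bigr => i _; rewrite mulrDl.
Qed.
Fact fps1_neq0 : fps1 != fps0.
Proof.
apply/eqP => /(congr1 (fun f : {fps k} => f 0%N)) /= /eqP.
by rewrite oner_eq0.
Qed.

HB.instance Definition _ := GRing.Zmodule_isComNzRing.Build {fps k}
  fps_mulA fps_mulC fps_mul1 fps_mulDl fps1_neq0.

Definition fps_unit : {pred {fps k}} := fun f => `[< exists g, g * f = 1 >].
Definition fps_inv f : {fps k} :=
  if f \in fps_unit then xget 0 [set g | g * f = 1] else f.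

Fact fps_mulVf : {in fps_unit, left_inverse 1 fps_inv *%R}.
Proof.
move=> f fU; rewrite /fps_inv fU.
by have /asboolP/(xgetPex 0) := fU; apply.
Qed.
Fact fps_unitPl f g : g * f = 1 -> fps_unit f.
Proof. by move=> gf; apply/asboolP; exists g. Qed.
Fact fps_inv_out : {in [predC fps_unit], fps_inv =1 id}.
Proof. by move=> f; rewrite inE /fps_inv => /negbTE ->. Qed.

HB.instance Definition _ := GRing.ComNzRing_hasMulInverse.Build {fps k}
  fps_mulVf fps_unitPl fps_inv_out.

Fact fps_mulf_eq0 f g : f * g = 0 -> (f == 0) || (g == 0).
Proof.
move=> fg0; apply: contraPT fg0; rewrite negb_or => /andP[f0 g0].
have nz h : h != 0 -> exists n, h n != 0.
  move=> h0; apply: contrapT => hn; move/eqP: h0; apply; apply: fpsP => n.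
  by apply/eqP; apply: contrapT => /negP hn0; apply: hn; exists n.
case: (ex_minnP (nz _ f0)) => i fi imin.
case: (ex_minnP (nz _ g0)) => j gj jmin.
move=> /(congr1 (fun h : {fps k} => h (i + j)%N)) /=.
have iP : (i < (i + j).+1)%N by rewrite ltnS leq_addr.
rewrite (bigD1 (Ordinal iP)) //= addKn big1 ?addr0; last first.
  move=> l; rewrite -val_eqE /= neq_ltn => /orP[li|il].
    have [->|/imin] := eqVneq (f l) 0; first by rewrite mul0r.
    by rewrite leqNgt li.
  have [->|/jmin] := eqVneq (g (i + j - l)%N) 0; first by rewrite mulr0.
  have ll : (l <= i + j)%N by rewrite -ltnS.
  by rewrite leq_subRL // leq_add2r leqNgt il.
by move/eqP; rewrite mulf_eq0 (negbTE fi) (negbTE gj).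
Qed.

HB.instance Definition _ := GRing.ComUnitRing_isIntegral.Build {fps k}
  fps_mulf_eq0.

Definition fpsX : {fps k} := FPS (fun n => (n == 1%N)%:R).
Definition fps_coef0 f : k := f 0%N.

End FpsRing.

Definition is_dvr (R : idomainType) (pi : R) :=
  [/\ pi != 0, pi \isn't a GRing.unit
    & forall x : R, x != 0 ->
        exists u n, u \is a GRing.unit /\ x = u * pi ^+ n].

(* rho presents kappa as the residue field R / pi R. *)
Definition is_residue_map (R : idomainType) (pi : R) (kappa : fieldType)
    (rho : R -> kappa) :=
  (forall c, exists x, rho x = c) /\
  (forall x, rho x = 0 <-> exists y, x = pi * y).

Definition weight d := {ffun 'I_d -> int}.

Section Lattices.
Context {A : idomainType} {d : nat}.
Local Notation K := {fraction A}.
Implicit Types (B e : 'M[K]_d) (L M : set 'cV[K]_d).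

Definition span B : set 'cV[K]_d := [set B *m map_mx tofrac c | c in setT].

(* For L free over A, L (x) K -> K^d is an isomorphism exactly when an A-basis
   of L is a K-basis of K^d; the columns of B are such a basis. *)
Definition is_lattice L := exists2 B, B \in unitmx & L = span B.

Definition scale (c : K) L : set 'cV[K]_d := [set c *: x | x in L].
Definition transform (g : 'M[K]_d) L : set 'cV[K]_d := [set g *m x | x in L].

Definition homothety_class L : set (set 'cV[K]_d) :=
  [set M | exists2 c : K, c != 0 & M = scale c L].

Definition is_class (C : set (set 'cV[K]_d)) :=
  exists2 L, is_lattice L & C = homothety_class L.

Definition adjacent (p : A) (C1 C2 : set (set 'cV[K]_d)) :=
  C1 <> C2 /\
  exists L1 L2, [/\ C1 L1, C2 L2, scale (tofrac p) L1 `<=` L2 & L2 `<=` L1].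

Definition convex_configuration (Gamma : set (set (set 'cV[K]_d))) :=
  [/\ finite_set Gamma, Gamma !=set0,
      (forall C, Gamma C -> is_class C)
    & forall C1 C2 L1 L2, Gamma C1 -> Gamma C2 -> C1 L1 -> C2 L2 ->
        Gamma (homothety_class (L1 `&` L2))].

(* The columns of [adapted p e a] are p^(- a(k)) e_k, e_k the columns of e. *)
Definition adapted (p : A) e (a : weight d) : 'M[K]_d :=
  e *m diag_mx (\row_k (tofrac p ^ (- a k))).

Definition latt (p : A) e (a : weight d) : set 'cV[K]_d := span (adapted p e a).

Definition in_apartment (p : A) e (Gamma : set (set (set 'cV[K]_d))) :=
  e \in unitmx /\
  forall C, Gamma C -> exists a : weight d, C = homothety_class (latt p e a).

(* Reduction modulo the maximal ideal. L/pL, for a lattice L = span B, is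
   identified with kappa^d through the basis formed by the classes of the
   columns of B; [reduction B] is then the projection L -> L/pL. Elements of
   K outside A are sent to 0, and the values outside L are irrelevant. *)
Context {kappa : fieldType} (rho : A -> kappa).

Definition residue (x : K) : kappa := rho (xget 0 [set c : A | tofrac c = x]).

Definition reduction B (x : 'cV[K]_d) : 'cV[kappa]_d :=
  map_mx residue (invmx B *m x).

Definition min_exponent (p : A) L M : int :=
  xget 0 [set n : int | scale (tofrac p ^ n) L `<=` M /\
            forall m : int, scale (tofrac p ^ m) L `<=` M -> n <= m].

(* With L = span B and M = span C, the map L/pL -> M/pM induced by
   multiplication by p^n, n = min_exponent p L M: the matrix below expresses
   the images p^n B_k of the basis of L in the basis of M, modulo p. *)
Definition linking_map (p : A) B C : 'Hom('cV[kappa]_d, 'cV[kappa]_d) :=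
  linfun (mulmx (map_mx residue
    (tofrac p ^ min_exponent p (span B) (span C) *: (invmx C *m B)))).

End Lattices.

Record ext_weyl d := ExtWeyl { ew_perm : 'S_d; ew_trans : weight d }.

HB.instance Definition _ d := gen_eqMixin (ext_weyl d).
HB.instance Definition _ d := gen_choiceMixin (ext_weyl d).

Section ExtWeylGroup.
Context {d : nat}.
Implicit Types (w : ext_weyl d) (s : 'S_d) (a : weight d).

Definition permute s a : weight d := [ffun k => a ((s^-1)%g k)].

Definition ew_act w a : weight d := permute (ew_perm w) a + ew_trans w.

(* In MathComp the product s2 * s1 of permutations is "first s2, then s1". *)
Definition ew_mul w1 w2 : ext_weyl d :=
  ExtWeyl (ew_perm w2 * ew_perm w1)%g
          (ew_trans w1 + permute (ew_perm w1) (ew_trans w2)).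
Definition ew_one : ext_weyl d := ExtWeyl 1%g 0.
Definition ew_inv w : ext_weyl d :=
  ExtWeyl (ew_perm w)^-1%g (- permute (ew_perm w)^-1%g (ew_trans w)).

Lemma permuteM s t a : permute s (permute t a) = permute (t * s)%g a.
Proof. by apply/ffunP => k; rewrite !ffunE invMg permM. Qed.
Lemma permute1 a : permute 1%g a = a.
Proof. by apply/ffunP => k; rewrite !ffunE invg1 perm1. Qed.
Lemma permuteD s a b : permute s (a + b) = permute s a + permute s b.
Proof. by apply/ffunP => k; rewrite !ffunE. Qed.
Lemma permuteN s a : permute s (- a) = - permute s a.
Proof. by apply/ffunP => k; rewrite !ffunE. Qed.
Lemma permute0 s : permute s 0 = 0.
Proof. by apply/ffunP => k; rewrite !ffunE. Qed.

Fact ew_mulA : associative ew_mul.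
Proof.
by move=> x y z; congr ExtWeyl => /=;
  rewrite ?mulgA // permuteD permuteM addrA.
Qed.
Fact ew_mul1 : left_id ew_one ew_mul.
Proof. by case=> s v; rewrite /ew_mul /= mulg1 permute1 add0r. Qed.
Fact ew_mulr1 : right_id ew_one ew_mul.
Proof. by case=> s v; rewrite /ew_mul /= mul1g permute0 addr0. Qed.
Fact ew_mulV : left_inverse ew_one ew_inv ew_mul.
Proof. by case=> s v; rewrite /ew_mul /ew_one /= mulgV addNr. Qed.
Fact ew_mulrV : right_inverse ew_one ew_inv ew_mul.
Proof.
case=> s v; rewrite /ew_mul /ew_one /= mulVg permuteN permuteM mulVg.
by rewrite permute1 subrr.
Qed.

HB.instance Definition _ := isGroup.Build (ext_weyl d)
  ew_mulA ew_mul1 ew_mulr1 ew_mulV ew_mulrV.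

Lemma ew_actM w1 w2 a : ew_act (w1 * w2)%g a = ew_act w1 (ew_act w2 a).
Proof. by rewrite /ew_act /= permuteD permuteM addrA addrAC. Qed.

Definition affine_weyl : set (ext_weyl d) :=
  [set w | \sum_k ew_trans w k = 0].

Definition fixer (X : set (weight d)) : set (ext_weyl d) :=
  [set w | affine_weyl w /\ forall a, X a -> ew_act w a = a].

Definition omega (i : 'I_d) : weight d := [ffun k : 'I_d => (k < i)%N%:Z].

(* Positions are numbered from 0 to d-1: for i = 0, ord_pred i is the last
   position and s_0 = ((1 d), (1,0,...,0,-1)); for i > 0, s_i = ((i i+1), 0). *)
Definition simple_reflection (i : 'I_d) : ext_weyl d :=
  ExtWeyl (tperm (ord_pred i) i)
    [ffun k : 'I_d => if val i == 0%N
                      then (val k == 0%N)%:Z - (val k == d.-1)%:Z else 0].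

(* The element ((1 2 ... d), (1,0,...,0)). *)
Definition iota_rot : ext_weyl d :=
  ExtWeyl (perm (@ordS_inj d)) [ffun k : 'I_d => (val k == 0%N)%:Z].

End ExtWeylGroup.

Section Bruhat.
Local Open Scope group_scope.
Context {G : groupType} {I : Type} (s : I -> G).
Implicit Types (u w x : G) (H J : set G).

Definition word_prod (l : seq I) : G := \prod_(i <- l) s i.

Definition coxeter_group : set G := [set word_prod l | l in setT].

Definition coxeter_length w : nat :=
  xget 0%N [set n : nat | (exists2 l, word_prod l = w & size l = n) /\
                    forall l, word_prod l = w -> (n <= size l)%N].

Definition reflection : set G :=
  [set w * s i * w^-1 | w in coxeter_group & i in setT].

Definition bruhat_step u w :=
  [/\ coxeter_group u, exists2 t, reflection t & w = u * t
    & (coxeter_length u < coxeter_length w)%N].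

Definition bruhat_le : G -> G -> Prop := clos_refl_trans G bruhat_step.

(* x^F: the element of minimal length in x H, for H = W_F. *)
Definition min_rep H x : G :=
  xget x [set y | (exists2 z, H z & y = x * z) /\
            forall z, H z -> (coxeter_length y <= coxeter_length (x * z))%N].

(* The element of maximal length in { (u w)^F | u in J }. *)
Definition double_coset_rep J H w : G :=
  xget w [set y | (exists2 u, J u & y = min_rep H (u * w)) /\
            forall u, J u ->
              (coxeter_length (min_rep H (u * w)) <= coxeter_length y)%N].

Definition double_coset_le J H w w' :=
  bruhat_le (double_coset_rep J H w) (double_coset_rep J H w').

End Bruhat.

Section Configuration.
Context {R : idomainType} (pi : R) {kappa : fieldType} (rho : R -> kappa).
Context {d : nat} (r : nat) (e : 'M[{fraction R}]_d).
Context {V : finType} (a : V -> weight d).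
Local Notation K := {fraction R}.
Local Notation L v := (latt pi e (a v)).

Definition represents (Gamma : set (set (set 'cV[K]_d))) :=
  injective (fun v => homothety_class (L v)) /\
  Gamma = [set homothety_class (L v) | v in setT].

Definition pairwise_adjacent (t : {set V}) :=
  forall u v, u \in t -> v \in t -> u != v ->
    adjacent pi (homothety_class (L u)) (homothety_class (L v)).

(* The maximal simplices tau_j; this type is the index set of the j's. *)
Definition max_simplex : Type :=
  {t : {set V} | maxset (fun t => `[< pairwise_adjacent t >]) t}.

Implicit Types (j : max_simplex) (h : max_simplex -> ext_weyl d).

Definition simplex_weights j : set (weight d) := [set a v | v in [set` val j]].

(* The representatives of the vertices of every tau_j can be ordered as
   L_0 <= L_1 <= ... <= pi^-1 L_0. *)
Definition chain_representatives :=
  forall j, exists v0 s,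
    [/\ v0 :: s =i val j,
        path (fun u v => `[< L u `<=` L v >]) v0 s
      & L (last v0 s) `<=` scale (tofrac pi)^-1 (L v0)].

Definition standard_position (g : max_simplex -> ext_weyl d)
    (I : max_simplex -> {set 'I_d}) :=
  forall j, simplex_weights j = [set ew_act (g j) (omega i) | i in [set` I j]].

Definition linking (u v : V) : 'Hom('cV[kappa]_d, 'cV[kappa]_d) :=
  linking_map rho pi (adapted pi e (a u)) (adapted pi e (a v)).

(* The kappa-points of the special fibre of LG_r; kappa is algebraically
   closed. *)
Definition LG_point (U : V -> {vspace 'cV[kappa]_d}) :=
  (forall v, \dim (U v) = r) /\ (forall u v, (linking u v @: U u <= U v)%VS).

Definition rank_vector (U : V -> {vspace 'cV[kappa]_d}) (uv : V * V) : nat :=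
  \dim (linking uv.1 uv.2 @: U uv.1)%VS.

Definition rank_le (U U' : V -> {vspace 'cV[kappa]_d}) :=
  forall uv, (rank_vector U uv <= rank_vector U' uv)%N.

(* The tuple (h_j W_j)_j is given by its coset representatives h_j. *)

Definition stab j : set (ext_weyl d) := fixer (simplex_weights j).
Definition stab2 j j' : set (ext_weyl d) :=
  fixer [set a v | v in [set` val j :&: val j']].

Definition double_coset (H : set (ext_weyl d)) (w : ext_weyl d) :
    set (ext_weyl d) :=
  [set (x * w * y)%g | x in H & y in H].

Definition admissible h :=
  (forall j v, v \in val j ->
     (forall k, a v k <= ew_act (h j) (a v) k <= a v k + 1) /\
     \sum_k ew_act (h j) (a v) k - \sum_k a v k = r%:Z) /\
  (forall j j', double_coset (stab2 j j') (h j) =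
                double_coset (stab2 j j') (h j')).

Local Notation Kt := {fraction {fps kappa}}.
Local Notation t := (@fpsX kappa).

Definition Lambda (b : weight d) : set 'cV[Kt]_d := latt t 1%:M b.

(* The preimage in Lambda(a_v) of E, a subspace of
   Lambda(a_v)/t Lambda(a_v) = L_v/pi L_v = kappa^d. *)
Definition lifted (v : V) (E : {vspace 'cV[kappa]_d}) : set 'cV[Kt]_d :=
  [set x | Lambda (a v) x /\
           reduction fps_coef0 (adapted t 1%:M (a v)) x \in E].

Definition parahoric j : set 'M[Kt]_d :=
  [set p | \det p = 1 /\
     forall v, v \in val j -> transform p (Lambda (a v)) = Lambda (a v)].

Definition bruhat_stratum h : set (V -> {vspace 'cV[kappa]_d}) :=
  [set U | LG_point U /\
     forall j, exists2 p, parahoric j p &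
       forall v, v \in val j ->
         scale (tofrac t)^-1 (lifted v (U v)) =
         transform p (Lambda (ew_act (h j) (a v)))].

(* The double cosets of W_j are compared in the Coxeter structure of W_a for
   which tau_j = g_j . omega_{I_j} is a face of the base alcove: simple
   reflections and iota are those of the standard alcove transported by g_j,
   and F_j = (iota_j^r g_j) . omega_{I_j} is then a face of the same alcove.
   With respect to a fixed alcove not containing tau_j, the double cosets
   would in general have no unique representative of maximal length. *)

Section Order.
Variables (g : max_simplex -> ext_weyl d) (I : max_simplex -> {set 'I_d}).
Local Open Scope group_scope.

Definition simple_at j (i : 'I_d) : ext_weyl d :=
  g j * simple_reflection i * (g j)^-1.
Definition iota_at j : ext_weyl d := g j * iota_rot * (g j)^-1.

Definition face_stab j : set (ext_weyl d) :=
  fixer [set ew_act (iota_at j ^+ r * g j) (omega i) | i in [set` I j]].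

Definition generalized_bruhat_le h h' :=
  forall j, double_coset_le (simple_at j) (stab j) (face_stab j)
              (h j * iota_at j ^- r) (h' j * iota_at j ^- r).

End Order.

End Configuration.

(* Main.v *)
(** Write [d = n + 2]. An element of the extended affine Weyl group acts on
the set [Z] of positions (the position [m d + k] is the basis vector
[t^-m e_k]), and its rank function counts, for all [p] and [q], the positions
below [q] that it sends to at least [p]. Reflections that create an inversion
raise the rank function; conversely, if the rank function of [x] lies below
that of [y], then at a descent [s] of [y] the inequality passes to [min (x, x s)]
and [y s], and the lifting property gives [x <= y] by induction on [y]. Hence
the Bruhat order of [W_a] is the order of rank functions.

On [W_J \ W_a / W_F] it suffices to compare the rank functions in the rows of
the vertices of [J] and the columns of the vertices of [F]: between such
columns the rank function of the representative is convex, and between such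
rows it is concave, hence both are extremal for their boundary values. For a
simplex [tau_j] these remaining numbers are the ranks of the linking maps
between vertices of [tau_j], or are forced by admissibility.

Finally, for arbitrary [u] and [v] the linking map from [u] to [v] has the
kernel of the one from [u] to an adjacent vertex, because [Gamma] is convex, so
the ranks between adjacent vertices determine all ranks. *)

Require Import Defs.
From HB Require Import structures.
From mathcomp Require Import all_boot all_order all_fingroup all_algebra.
From mathcomp Require Import generic_quotient fraction.
From mathcomp Require Import boolp classical_sets.
From mathcomp Require Import zify ring.
From Stdlib Require Import Relation_Operators Operators_Properties.

Set Implicit Arguments.
Unset Strict Implicit.
Unset Printing Implicit Defensive.

Import Order.TTheory GRing.Theory Num.Theory.

Local Open Scope classical_set_scope.
Local Open Scope ring_scope.

Local Notation tofrac := (@FracField.tofrac _).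

(** * Positions, affine permutations and rank functions *)

Section Positions.
Context {n : nat}.
Local Notation d := n.+2.
Implicit Types (a b : weight d) (w u t : ext_weyl d) (m N P Q p q : int).

Definition lvl N : int := (N %/ d%:Z)%Z.
Definition res N : 'I_d := inord `|(N %% d%:Z)%Z|%N.
Definition mkpos m (k : 'I_d) : int := m * d%:Z + (k : nat)%:Z.

Lemma res_val N : (res N : nat)%:Z = (N %% d%:Z)%Z.
Proof.
have N0 : 0 <= (N %% d%:Z)%Z by apply: modz_ge0.
have Nd : (N %% d%:Z)%Z < d%:Z by apply: ltz_pmod.
rewrite /res inordK; last by lia.
by rewrite gez0_abs.
Qed.

Lemma mkposK N : mkpos (lvl N) (res N) = N.
Proof. by rewrite /mkpos res_val -divz_eq. Qed.

Lemma lvl_mkpos m k : lvl (mkpos m k) = m.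
Proof. by rewrite /lvl /mkpos divzMDl // divz_small ?addr0 //= ltz_nat ltn_ord. Qed.

Lemma res_mkpos m k : res (mkpos m k) = k.
Proof.
apply/val_inj/eqP; rewrite -eqz_nat res_val /mkpos modzMDl modz_small //.
by rewrite /= ltz_nat ltn_ord.
Qed.

Lemma res_nat (k : 'I_d) : res (k : nat)%:Z = k.
Proof. by rewrite -{2}(res_mkpos 0 k) /mkpos mul0r add0r. Qed.

Lemma resDM N m : res (N + m * d%:Z) = res N.
Proof.
by rewrite -{1}[N]mkposK /mkpos addrAC -mulrDl res_mkpos.
Qed.

Lemma lvlDM N m : lvl (N + m * d%:Z) = lvl N + m.
Proof.
by rewrite -{1}[N]mkposK /mkpos addrAC -mulrDl lvl_mkpos.
Qed.

Lemma res_eqP N M : reflect (exists m, N = M + m * d%:Z) (res N == res M).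
Proof.
apply: (iffP eqP) => [NM|[m ->]]; last exact: resDM.
exists (lvl N - lvl M); rewrite -{1}[N]mkposK -{1}[M]mkposK /mkpos NM.
by rewrite mulrBl; lia.
Qed.

Lemma resD N M c : res N = res M -> res (N + c) = res (M + c).
Proof. by move/eqP/res_eqP => [m ->]; rewrite addrAC resDM. Qed.

Lemma resD1_neq N : res (N + 1) != res N.
Proof.
apply/negP => /res_eqP [m] /addrI h.
have : (`|1%:Z| = `|m| * d)%N by rewrite -[d]/`|d%:Z|%N -abszM -h.
by move/esym/eqP; rewrite muln_eq1 andbF.
Qed.

Lemma res_pred (i : 'I_d) : res ((i : nat)%:Z - 1) = ord_pred i.
Proof.
apply/val_inj/eqP; rewrite -eqz_nat res_val /=; case: i => -[|i] /= id.
  rewrite (_ : 0%:Z - 1 = (-1) * d%:Z + n.+1%:Z); last by lia.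
  by rewrite modzMDl modz_small ?modn_small //=; lia.
rewrite (_ : i.+1%:Z - 1 = i%:Z); last by lia.
by rewrite modnDr modn_small ?modz_small //=; lia.
Qed.

Lemma res_predE N (i : 'I_d) : (res N == ord_pred i) = (res (N + 1) == i).
Proof.
rewrite -res_pred -{2}[i]res_nat; apply/eqP/eqP => /resD h.
  by rewrite (h 1) subrK.
by rewrite -(h (-1)) addrK.
Qed.

Lemma ord_pred_neq (i : 'I_d) : ord_pred i != i.
Proof.
by rewrite -res_pred -{2}[i]res_nat -{2}[i%:Z](subrK 1) eq_sym resD1_neq.
Qed.

(** The affine permutation of the integers attached to [w]. The translation is read at the image
    residue, since [ew_act] permutes first and translates afterwards; [apDM] is the periodicity. *)
Definition ap w N : int :=
  mkpos (lvl N + ew_trans w (ew_perm w (res N))) (ew_perm w (res N)).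

Lemma res_ap w N : res (ap w N) = ew_perm w (res N).
Proof. exact: res_mkpos. Qed.

Lemma ap1 N : ap 1%g N = N.
Proof. by rewrite /ap /= perm1 ffunE addr0 mkposK. Qed.

Lemma apM w u N : ap (w * u)%g N = ap w (ap u N).
Proof.
rewrite {2}/ap res_ap lvl_mkpos /ap /= permM !ffunE permK.
by congr mkpos; rewrite -[RHS]addrA; congr (_ + _); apply: addrC.
Qed.

Lemma apK w : cancel (ap w) (ap w^-1%g).
Proof. by move=> N; rewrite -apM mulVg ap1. Qed.

Lemma apKV w : cancel (ap w^-1%g) (ap w).
Proof. by move=> N; rewrite -apM mulgV ap1. Qed.

Lemma ap_inj w : injective (ap w).
Proof. exact: can_inj (apK w). Qed.

Lemma apDM w N m : ap w (N + m * d%:Z) = ap w N + m * d%:Z.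
Proof. by rewrite /ap resDM lvlDM /mkpos -!addrA mulrDl mulrDl; lia. Qed.

Lemma ap_eq w u : (forall k : 'I_d, ap w (k : nat)%:Z = ap u (k : nat)%:Z) -> w = u.
Proof.
case: w u => s v [s' v'] /= e.
have ss k : s k = s' k by have := congr1 res (e k); rewrite !res_ap /= !res_nat.
congr ExtWeyl; first exact/permP.
apply/ffunP => k; have := congr1 lvl (e ((s^-1)%g k)).
by rewrite !lvl_mkpos /= !res_nat -ss permKV => /addrI.
Qed.

Definition trans_sum w : int := \sum_k ew_trans w k.

Lemma trans_sumM w u : trans_sum (w * u)%g = trans_sum w + trans_sum u.
Proof.
rewrite /trans_sum /= (reindex_inj (@perm_inj _ (ew_perm w))) /=.
rewrite [in RHS](reindex_inj (@perm_inj _ (ew_perm w))) /= -big_split /=.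
by apply: eq_bigr => k _; rewrite !ffunE permK.
Qed.

Lemma trans_sum1 : trans_sum 1%g = 0.
Proof. by rewrite /trans_sum big1 // => k _; rewrite ffunE. Qed.

Lemma trans_sumV w : trans_sum w^-1%g = - trans_sum w.
Proof.
by apply/eqP; rewrite -addr_eq0 -trans_sumM mulVg trans_sum1.
Qed.

Lemma trans_sumJ w u : trans_sum (w ^ u)%g = trans_sum w.
Proof. by rewrite conjgE !trans_sumM trans_sumV; lia. Qed.

(** Over one period the residues are merely permuted and cancel, so only the translations
    contribute, each with weight [d]. *)
Lemma sum_ap w : \sum_(k < d) (ap w (k : nat)%:Z - (k : nat)%:Z) =
  trans_sum w * d%:Z.
Proof.
rewrite sumrB [X in _ - X](reindex_inj (@perm_inj _ (ew_perm w))) /= -sumrB.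
rewrite /trans_sum [in RHS](reindex_inj (@perm_inj _ (ew_perm w))) /= mulr_suml.
apply: eq_bigr => k _; rewrite /ap res_nat (_ : lvl _ = 0) ?add0r /mkpos ?addrK //.
by rewrite -(lvl_mkpos 0 k) /mkpos mul0r add0r.
Qed.

(** An increasing bijection of the integers is a shift, and by [sum_ap] a shift with translation sum
    zero is trivial. *)
Lemma ap_mono_eq1 w : trans_sum w = 0 ->
  (forall N, ap w N < ap w (N + 1)) -> w = 1%g.
Proof.
move=> w0 wS.
have wD (k : nat) N : (0 < k)%N -> ap w N < ap w (N + k%:Z).
  elim: k => // -[|k] IH _; first exact: wS.
  by apply: lt_trans (IH isT) _; rewrite (_ : k.+2%:Z = k.+1%:Z + 1) ?addrA //; lia.
have wlt N M : N < M -> ap w N < ap w M.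
  by move=> NM; rewrite (_ : M = N + `|M - N|%N%:Z); [apply: wD|]; lia.
have w1 N : ap w (N + 1) = ap w N + 1.
  apply/eqP; rewrite eq_le; apply/andP; split; last by have := wS N; lia.
  rewrite leNgt; apply/negP => h.
  (* If a value were skipped between [N] and [N + 1], its preimage would have to lie strictly
     between these two integers. *)
  set K := ap w^-1%g (ap w N + 1); have eK : ap w K = ap w N + 1 by apply: apKV.
  have [KN|NK] := leP K N.
    by move: KN; rewrite le_eqVlt => /orP[/eqP KN|/wlt]; [move: eK; rewrite KN|]; lia.
  have : N + 1 <= K by lia.
  by rewrite le_eqVlt => /orP[/eqP KN|/wlt]; [move: h; rewrite KN eK|]; lia.
have wk (k : nat) : ap w k%:Z = ap w 0 + k%:Z.
  elim: k => [|k IH]; rewrite ?addr0 // (_ : k.+1%:Z = k%:Z + 1); last by lia.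
  by rewrite w1 IH addrA.
have c0 : ap w 0 = 0.
  have := sum_ap w; rewrite w0 mul0r (eq_bigr (fun=> ap w 0)).
    by rewrite sumr_const card_ord => /eqP; rewrite mulrn_eq0 => /eqP.
  by move=> k _; rewrite wk addrK.
by apply: ap_eq => k; rewrite wk c0 add0r ap1.
Qed.

(** An affine reflection: it exchanges [P + m d] and [Q + m d] for all [m] at once, which requires
    two distinct residue classes. *)
Definition is_swap t P Q :=
  res P != res Q /\
  forall N, ap t N = if res N == res P then N + (Q - P)
                     else if res N == res Q then N - (Q - P) else N.

Lemma is_swap_uniq t u P Q : is_swap t P Q -> is_swap u P Q -> t = u.
Proof. by move=> [_ tE] [_ uE]; apply: ap_eq => k; rewrite tE uE. Qed.

Lemma is_swapC t P Q : is_swap t P Q -> is_swap t Q P.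
Proof.
move=> [PQ tE]; split=> [|N]; first by rewrite eq_sym.
rewrite tE; case: (eqVneq (res N) (res P)) => [->|_].
  by rewrite (negbTE PQ); lia.
by case: ifP => // _; lia.
Qed.

Lemma is_swapJ t u P Q : is_swap t P Q ->
  is_swap (u * t * u^-1)%g (ap u P) (ap u Q).
Proof.
move=> [PQ tE]; split=> [|N]; first by rewrite !res_ap (inj_eq perm_inj).
rewrite !apM tE; move: (ap u^-1%g N) (apKV u N) => M <-.
rewrite !res_ap !(inj_eq perm_inj).
case: ifP => [/res_eqP [m ->]|_].
  by rewrite [in RHS]apDM addrAC addrCA subrr addr0 apDM; lia.
case: ifP => [/res_eqP [m ->]|//].
rewrite [in RHS]apDM (_ : Q + m * d%:Z - (Q - P) = P + m * d%:Z) ?apDM; lia.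
Qed.

Lemma is_swapL t P Q : is_swap t P Q -> ap t P = Q.
Proof. by move=> [_ ->]; rewrite eqxx addrC subrK. Qed.

Lemma is_swapR t P Q : is_swap t P Q -> ap t Q = P.
Proof. by move/is_swapC/is_swapL. Qed.

Lemma is_swap2 t P Q : is_swap t P Q -> (t * t)%g = 1%g.
Proof.
move=> tPQ; have [_ tE] := tPQ; apply: ap_eq => k; move: (k : nat)%:Z => N.
rewrite apM ap1; have [/eqP/res_eqP[m ->]|NP] := eqVneq (res N) (res P).
  by rewrite apDM (is_swapL tPQ) apDM (is_swapR tPQ).
have [/eqP/res_eqP[m ->]|NQ] := eqVneq (res N) (res Q).
  by rewrite apDM (is_swapR tPQ) apDM (is_swapL tPQ).
by rewrite !tE (negbTE NP) (negbTE NQ) (negbTE NP) (negbTE NQ).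
Qed.

(** On positions the generator with index 0 is no exception: its translation part turns the exchange
    of the first and last residues into that of the neighbours -1 and 0. *)
Lemma simple_reflection_swap (i : 'I_d) :
  is_swap (simple_reflection i) ((i : nat)%:Z - 1) (i : nat)%:Z.
Proof.
have pi := ord_pred_neq i.
split; rewrite res_nat res_pred // => N.
rewrite /ap /=; case: tpermP => [Np|Ni|/eqP/negbTE Np /eqP/negbTE Ni].
- rewrite Np eqxx -[in RHS](mkposK N) Np /mkpos ffunE.
  case: i {Np pi} => -[|i] id //=; last first.
    rewrite modnDr modn_small ?(ltnW id) //; lia.
  by rewrite modn_small //; lia.
- rewrite Ni [i == _]eq_sym (negbTE pi) eqxx -[in RHS](mkposK N) Ni /mkpos ffunE.
  case: i {Ni pi} => -[|i] id //=; last first.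
    rewrite modnDr modn_small ?(ltnW id) //; lia.
  by rewrite modn_small //=; rewrite ?eqxx; lia.
- rewrite Np Ni ffunE; set x := if _ then _ else _.
  suff -> : x = 0 by rewrite addr0 mkposK.
  rewrite /x; case: i Np Ni {x pi} => -[|i] id //= Np Ni.
  move: Np Ni; rewrite -!val_eqE /= modn_small // => -> ->.
  by rewrite subrr.
Qed.

Definition cst_weight m : weight d := [ffun=> m].

Lemma ew_actDc w a m : ew_act w (a + cst_weight m) = ew_act w a + cst_weight m.
Proof. by apply/ffunP => k; rewrite !ffunE addrAC. Qed.

Lemma ew_act1 a : ew_act 1%g a = a.
Proof. by apply/ffunP => k; rewrite !ffunE invg1 perm1 addr0. Qed.

Lemma ew_actK w : cancel (ew_act w) (ew_act w^-1%g).
Proof. by move=> a; rewrite -ew_actM mulVg ew_act1. Qed.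

Lemma ew_actKV w : cancel (ew_act w^-1%g) (ew_act w).
Proof. by move=> a; rewrite -ew_actM mulgV ew_act1. Qed.

Lemma ew_actE w a k : ew_act w a (ew_perm w k) = a k + ew_trans w (ew_perm w k).
Proof. by rewrite !ffunE permK. Qed.

Lemma sum_ew_act w a :
  \sum_k ew_act w a k = \sum_k a k + trans_sum w.
Proof.
rewrite (reindex_inj (@perm_inj _ (ew_perm w))) /trans_sum.
rewrite [X in _ + X](reindex_inj (@perm_inj _ (ew_perm w))) -big_split /=.
by apply: eq_bigr => k _; rewrite ew_actE.
Qed.

(* The height of the weight a above the position N; [0 < lev a N] says that N,
   as a basis vector of k((t))^d, lies in the lattice of a. *)
Definition lev a N : int := a (res N) - lvl N.

Lemma lev_act w a N : lev (ew_act w a) (ap w N) = lev a N.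
Proof. by rewrite /lev res_ap ew_actE /ap lvl_mkpos; lia. Qed.

Lemma levVact w a N : lev (ew_act w^-1%g a) N = lev a (ap w N).
Proof. by rewrite -(lev_act w^-1%g a (ap w N)) apK. Qed.

Lemma lev_mkpos a m k : lev a (mkpos m k) = a k - m.
Proof. by rewrite /lev res_mkpos lvl_mkpos. Qed.

Lemma weight_eq a b : (forall N, (0 < lev a N) = (0 < lev b N)) -> a = b.
Proof.
move=> e; suff ab (k : 'I_d) : a k = b k by apply/ffunP.
have := e (mkpos (a k) k); have := e (mkpos (b k) k); rewrite !lev_mkpos; lia.
Qed.

(* The lattice spanned by the positions below q; [alcove q] for q in a period
   are the vertices of the base alcove. *)
Definition alcove q : weight d :=
  [ffun k : 'I_d => ((q - 1 - (k : nat)%:Z) %/ d%:Z)%Z + 1].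

Lemma lev_alcove q N : lev (alcove q) N = ((q - 1 - N) %/ d%:Z)%Z + 1.
Proof.
rewrite /lev ffunE -{3}(mkposK N) /mkpos.
rewrite (_ : q - 1 - (_ + _) = (- lvl N) * d%:Z + (q - 1 - (res N : nat)%:Z)).
  by rewrite divzMDl //; lia.
by rewrite mulNr; lia.
Qed.

Lemma lev_alcove_gt0 q N : (0 < lev (alcove q) N) = (N < q).
Proof.
have := @divz_ge0 (q - 1 - N) d%:Z isT; rewrite lev_alcove; lia.
Qed.

Lemma lev_alcove_homo q M N : M <= N -> lev (alcove q) N <= lev (alcove q) M.
Proof. by move=> MN; rewrite !lev_alcove lerD2r lez_pdiv2r //; lia. Qed.

Lemma alcoveDM q m : alcove (q + m * d%:Z) = alcove q + cst_weight m.
Proof.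
apply/ffunP => k; rewrite !ffunE.
rewrite (_ : q + _ - 1 - _ = m * d%:Z + (q - 1 - (k : nat)%:Z)); last by lia.
by rewrite divzMDl //; lia.
Qed.

Lemma omegaE (i : 'I_d) : omega i = alcove (i : nat)%:Z.
Proof.
apply: weight_eq => N; rewrite lev_alcove_gt0 /lev ffunE.
rewrite -{3}(mkposK N) /mkpos; have := ltn_ord i; have := ltn_ord (res N).
by case: (ltnP (res N) i); nia.
Qed.

(** The reflection exchanges the neighbours [i - 1] and [i] modulo [d], so it preserves the
    half-line below [q] unless the boundary of the half-line separates such a pair. *)
Lemma alcove_fix (i : 'I_d) q :
  res q != i -> ew_act (simple_reflection i) (alcove q) = alcove q.
Proof.
move=> qi; apply: weight_eq => N.
rewrite -[N in LHS](apKV (simple_reflection i)) lev_act !lev_alcove_gt0.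
set M := ap _ _; have -> : N = ap (simple_reflection i) M by rewrite apKV.
have [_ ->] := simple_reflection_swap i.
rewrite res_nat res_pred (_ : i%:Z - (i%:Z - 1) = 1); last by lia.
case: eqP => [/eqP|_]; first rewrite res_predE => Mi.
  by case: (eqVneq q (M + 1)) qi => [->|]; [rewrite Mi|lia].
by case: eqP => [Mi|//]; case: (eqVneq q M) qi => [->|]; [rewrite Mi eqxx|lia].
Qed.

Lemma iota_alcove q : ew_act iota_rot (alcove q) = alcove (q + 1).
Proof.
have apI N : ap (@iota_rot d) N = N + 1.
  rewrite -{2}(mkposK N) /ap /= permE ffunE /mkpos /=.
  have := ltn_ord (res N); rewrite leq_eqVlt => /predU1P[[rN]|rN].
    by rewrite rN modnn eqxx; lia.
  by rewrite modn_small //=; lia.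
apply: weight_eq => N; rewrite -[N](apKV (@iota_rot d)) lev_act !lev_alcove_gt0 apI.
lia.
Qed.

Lemma trans_sum_iota : trans_sum (@iota_rot d) = 1.
Proof.
rewrite /trans_sum (bigD1 ord0) //= ffunE eqxx big1 ?addr0 // => k.
by rewrite ffunE -val_eqE /= => /negbTE ->.
Qed.

Lemma trans_sum_simple (i : 'I_d) : trans_sum (simple_reflection i) = 0.
Proof.
rewrite /trans_sum (eq_bigr (fun k : 'I_d => if val i == 0%N
  then (k == ord0)%:Z - (k == ord_max)%:Z else 0)); last first.
  by move=> k _; rewrite ffunE -!val_eqE /=; case: ifP.
case: (val i == 0%N); last by rewrite big1.
rewrite sumrB (bigD1 ord0) //= [X in _ - X](bigD1 ord_max) //= !eqxx.
by rewrite !big1 // => k /negbTE ->.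
Qed.

(** The length of the quotient of the lattice of [a] by its intersection with the lattice of [b]. *)
Definition dist a b : int := \sum_k Num.max 0 (a k - b k).

Lemma dist_ge0 a b : 0 <= dist a b.
Proof. by apply: sumr_ge0 => k _; rewrite le_max lexx. Qed.

Lemma dist_act w a b : dist (ew_act w a) (ew_act w b) = dist a b.
Proof.
rewrite /dist (reindex_inj (@perm_inj _ (ew_perm w))).
by apply: eq_bigr => k _; rewrite !ew_actE; congr Num.max; lia.
Qed.

Lemma distDc a b m : dist (a + cst_weight m) (b + cst_weight m) = dist a b.
Proof.
apply: eq_bigr => k _; congr Num.max.
by rewrite !ffunE opprD addrACA subrr addr0.
Qed.

Lemma dist_le0 a b : (forall k : 'I_d, a k <= b k) -> dist a b = 0.
Proof.
by move=> ab; apply: big1 => k _; apply/max_idPl; rewrite subr_le0.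
Qed.

Lemma dist_ge a b : (forall k : 'I_d, b k <= a k) ->
  dist a b = \sum_k a k - \sum_k b k.
Proof.
move=> ab; rewrite -sumrB; apply: eq_bigr => k _.
by apply/max_idPr; rewrite subr_ge0.
Qed.

(* The number of positions below q sent by w to a position at least p. *)
Definition pos_rank w q p : int := dist (ew_act w (alcove q)) (alcove p).

Lemma levDM a N m : lev a (N + m * d%:Z) = lev a N - m.
Proof. by rewrite /lev resDM lvlDM; lia. Qed.

Lemma alcoveS q k : alcove (q + 1) k = alcove q k + (k == res q)%:Z.
Proof.
case: eqP => [->|kq] /=.
  have := lev_alcove_gt0 q q; have := lev_alcove_gt0 q (q + (-1) * d%:Z).
  have := lev_alcove_gt0 (q + 1) q.
  have := lev_alcove_gt0 (q + 1) (q + 1 * d%:Z).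
  by rewrite !levDM /lev; lia.
have h m : (0 < alcove (q + 1) k - m) = (0 < alcove q k - m).
  rewrite -!lev_mkpos !lev_alcove_gt0; have : mkpos m k <> q; last by lia.
  by move=> e; apply: kq; rewrite -e res_mkpos.
by have := h (alcove q k); have := h (alcove (q + 1) k); lia.
Qed.

(** Enlarging the column adds the single position [q], so the increments of the rank function
    recover the permutation. *)
Lemma pos_rankS w q p :
  pos_rank w (q + 1) p = pos_rank w q p + (p <= ap w q)%R%:Z.
Proof.
rewrite /pos_rank /dist (bigD1 (res (ap w q))) //= [in RHS](bigD1 (res (ap w q))) //=.
rewrite [in RHS]addrAC; congr (_ + _); last first.
  apply: eq_bigr => k; rewrite -[k](permKV (ew_perm w)) res_ap (inj_eq perm_inj) => kq.
  by rewrite !ew_actE alcoveS (negbTE kq) addr0.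
have := lev_alcove_gt0 p (ap w q).
rewrite res_ap !ew_actE alcoveS eqxx /lev res_ap.
have := lev_alcove_gt0 q q; have := lev_alcove_gt0 q (q + (-1) * d%:Z).
rewrite levDM /lev (_ : lvl (ap w q) = lvl q + ew_trans w (ew_perm w (res q))).
  lia.
exact: lvl_mkpos.
Qed.

Lemma pos_rankV w q p :
  pos_rank w q p = dist (alcove q) (ew_act w^-1%g (alcove p)).
Proof. by rewrite -(dist_act w) ew_actKV. Qed.

Lemma pos_rankSr w q p :
  pos_rank w q p = pos_rank w q (p + 1) + (ap w^-1%g p < q)%R%:Z.
Proof.
rewrite !pos_rankV /dist; set v := w^-1%g.
rewrite (bigD1 (res (ap v p))) //= [in RHS](bigD1 (res (ap v p))) //=.
rewrite [in RHS]addrAC; congr (_ + _); last first.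
  apply: eq_bigr => k; rewrite -[k](permKV (ew_perm v)) res_ap (inj_eq perm_inj) => kp.
  by rewrite !ew_actE alcoveS (negbTE kp) addr0.
have := lev_alcove_gt0 q (ap v p).
rewrite res_ap !ew_actE alcoveS eqxx /lev res_ap.
have := lev_alcove_gt0 p p; have := lev_alcove_gt0 p (p + (-1) * d%:Z).
rewrite levDM /lev (_ : lvl (ap v p) = lvl p + ew_trans v (ew_perm v (res p))).
  lia.
exact: lvl_mkpos.
Qed.

Lemma pos_rank_ge0 w q p : 0 <= pos_rank w q p.
Proof. exact: dist_ge0. Qed.

Lemma distE a b (F : 'I_d -> int) : (forall k, res (F k) = k) ->
  dist a b = \sum_k Num.max 0 (lev a (F k) - lev b (F k)).
Proof. by move=> Fk; apply: eq_bigr => k _; rewrite /lev Fk; congr Num.max; lia. Qed.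

(** Summed over representatives [F] that contain [P] and [Q] themselves, the two ranks differ only
    in two terms. There the claim is a rearrangement inequality: the levels decrease along positions
    and [max(0, x - y)] is convex in [x - y]. *)
Lemma pos_rank_swap t u P Q q p : is_swap t P Q -> P < Q -> ap u P < ap u Q ->
  pos_rank u q p <= pos_rank (u * t)%g q p.
Proof.
move=> tPQ PQ uPQ; have [rPQ tE] := tPQ.
pose F (k : 'I_d) := if k == res P then P else if k == res Q then Q else (k : nat)%:Z.
have Fk k : res (F k) = k.
  by rewrite /F; case: eqP => [->|_] //; case: eqP => [->|_]; rewrite ?res_nat.
rewrite pos_rankV (distE _ _ Fk) /pos_rank -(dist_act u^-1%g) -ew_actM mulgA mulVg mul1g.
rewrite (distE _ _ Fk).
rewrite (bigD1 (res P)) //= (bigD1 (res Q)) 1?eq_sym //=.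
rewrite [leRHS](bigD1 (res P)) //= [X in _ <= _ + X](bigD1 (res Q)) 1?eq_sym //=.
rewrite [X in _ + (_ + X) <= _](eq_bigr (fun k => Num.max 0
  (lev (ew_act t (alcove q)) (F k) - lev (ew_act u^-1%g (alcove p)) (F k)))); last first.
  move=> k /andP[kP kQ]; congr (Num.max _ (_ - _)).
  rewrite -[in RHS](apKV t (F k)) lev_act; congr lev.
  by apply: (@ap_inj t); rewrite apKV tE Fk (negbTE kP) (negbTE kQ).
rewrite !addrA lerD2r /F eqxx eq_sym (negbTE rPQ) eqxx !levVact.
have -> : lev (ew_act t (alcove q)) P = lev (alcove q) Q.
  by rewrite -(lev_act t _ Q) (is_swapR tPQ).
have -> : lev (ew_act t (alcove q)) Q = lev (alcove q) P.
  by rewrite -(lev_act t _ P) (is_swapL tPQ).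
have := lev_alcove_homo q (ltW PQ); have := lev_alcove_homo p (ltW uPQ); lia.
Qed.

Lemma pos_rank1 q : pos_rank 1%g q q = 0.
Proof. by rewrite /pos_rank ew_act1 dist_le0. Qed.

(** The diagonal ranks of the identity vanish, so [w] raises no position; as the displacements over
    a period sum to zero, each of them is zero. *)
Lemma pos_rank_eq1 w : trans_sum w = 0 ->
  (forall q p, pos_rank w q p <= pos_rank 1%g q p) -> w = 1%g.
Proof.
move=> w0 w1.
have wq q : ap w q <= q.
  have := w1 (q + 1) (q + 1); rewrite pos_rank1 pos_rankS.
  by have := pos_rank_ge0 w q (q + 1); lia.
apply: ap_eq => k; rewrite ap1; apply/eqP; rewrite -subr_eq0 -oppr_eq0 opprB.
have := sum_ap w; rewrite w0 mul0r => /eqP; rewrite -oppr_eq0 -sumrN.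
rewrite psumr_eq0 => [/allP/(_ k)|i _]; last by rewrite opprB subr_ge0.
by rewrite opprB => /(_ (mem_index_enum _)).
Qed.

End Positions.

(** * Lengths and extremal coset representatives *)

Section CoxeterLength.
Local Open Scope group_scope.
Context {G : groupType} {I : Type} (s : I -> G).
Implicit Types (u w x t : G) (H : set G).
Local Notation len := (coxeter_length s).
Local Notation wd := (word_prod s).

Lemma word_prod_nil : wd [::] = 1. Proof. exact: big_nil. Qed.

Lemma word_prod_cons i l : wd (i :: l) = s i * wd l.
Proof. exact: big_cons. Qed.

Lemma word_prod_cat l l' : wd (l ++ l') = wd l * wd l'.
Proof. exact: big_cat. Qed.

Lemma coxeter_lengthP w : coxeter_group s w ->
  (exists2 l, wd l = w & size l = len w) /\
  (forall l, wd l = w -> (len w <= size l)%N).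
Proof.
move=> [l0 _ l0w]; rewrite /coxeter_length; set X := [set k | _].
have [k Xk] : exists k, X k.
  have ex : exists k, `[< exists2 l, wd l = w & size l = k >].
    by exists (size l0); apply/asboolP; exists l0.
  case: (ex_minnP ex) => k /asboolP kP kmin; exists k; split=> // l lw.
  by apply: kmin; apply/asboolP; exists l.
by have [lP lmin] := xgetPex 0%N (ex_intro _ k Xk).
Qed.

Lemma bruhat_le_length u w : bruhat_le s u w -> (len u <= len w)%N.
Proof.
elim=> [x y [_ _ /ltnW]|x|x y z _ xy _ yz] //; exact: leq_trans yz.
Qed.

Lemma min_repP H x : H 1 ->
  (exists2 z, H z & min_rep s H x = x * z) /\
  (forall z, H z -> (len (min_rep s H x) <= len (x * z)%g)%N).
Proof.
move=> H1; rewrite /min_rep; set X := [set y | _].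
suff [y Xy] : exists y, X y by have [] := xgetPex x (ex_intro _ y Xy).
have ex : exists k, `[< exists2 z, H z & len (x * z) = k >].
  by exists (len (x * 1)); apply/asboolP; exists 1.
case: (ex_minnP ex) => k /asboolP [z Hz zk] kmin; exists (x * z); split.
  by exists z.
by move=> z' Hz'; rewrite zk; apply: kmin; apply/asboolP; exists z'.
Qed.

(** The bound [B] guarantees that a longest element exists, so that the choice in [double_coset_rep]
    does not fall back on its default value. *)
Lemma double_coset_repP J H x (B : nat) : J 1 ->
  (forall u, J u -> (len (min_rep s H (u * x)%g) <= B)%N) ->
  (exists2 u, J u & double_coset_rep s J H x = min_rep s H (u * x)) /\
  (forall u, J u ->
    (len (min_rep s H (u * x)%g) <= len (double_coset_rep s J H x))%N).
Proof.
move=> J1 JB; rewrite /double_coset_rep; set X := [set y | _].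
suff [y Xy] : exists y, X y by have [] := xgetPex x (ex_intro _ y Xy).
have ex : exists k, `[< exists2 u, J u & len (min_rep s H (u * x)) = k >].
  by exists (len (min_rep s H (1 * x))); apply/asboolP; exists 1.
have ub k : `[< exists2 u, J u & len (min_rep s H (u * x)) = k >] -> (k <= B)%N.
  by move=> /asboolP [u Ju <-]; apply: JB.
case: (ex_maxnP ex ub) => k /asboolP [u Ju uk] kmax.
exists (min_rep s H (u * x)); split; first by exists u.
by move=> u' Ju'; rewrite uk; apply: kmax; apply/asboolP; exists u'.
Qed.

End CoxeterLength.

(** * The affine Weyl group as a Coxeter group, and strong exchange *)

Section AffineBruhat.
Context {n : nat}.
Local Notation d := n.+2.
Local Notation lvl := (@lvl n).
Local Notation res := (@res n).
Variable g : ext_weyl d.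
Implicit Types (w u x y t : ext_weyl d) (m N P Q p q : int) (i : 'I_d).

Definition grefl i : ext_weyl d := locked (g * simple_reflection i * g^-1)%g.
Local Notation wd := (word_prod grefl).
Local Notation cox := (coxeter_group grefl).

(* Conjugation by g moves the alcove of the Coxeter generators to the base
   alcove. *)
Definition gpos w N : int := ap (w ^ g)%g N.
Definition grank w q p : int := pos_rank (w ^ g)%g q p.

Lemma refl_conj i : (grefl i ^ g)%g = simple_reflection i.
Proof. by rewrite /grefl -lock conjgE !mulgA mulVg mul1g mulgKV. Qed.

Lemma posM w u N : gpos (w * u)%g N = gpos w (gpos u N).
Proof. by rewrite /gpos conjMg apM. Qed.

Lemma pos1 N : gpos 1%g N = N.
Proof. by rewrite /gpos conj1g ap1. Qed.

Lemma posK w : cancel (gpos w) (gpos w^-1%g).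
Proof. by move=> N; rewrite -posM mulVg pos1. Qed.

Lemma posKV w : cancel (gpos w^-1%g) (gpos w).
Proof. by move=> N; rewrite -posM mulgV pos1. Qed.

Lemma pos_inj w : injective (gpos w).
Proof. exact: can_inj (posK w). Qed.

Lemma posDM w N m : gpos w (N + m * d%:Z) = gpos w N + m * d%:Z.
Proof. exact: apDM. Qed.

Definition gswap t P Q := is_swap (t ^ g)%g P Q.

Lemma swap_refl i : gswap (grefl i) ((i : nat)%:Z - 1) (i : nat)%:Z.
Proof. by rewrite /gswap refl_conj; apply: simple_reflection_swap. Qed.

Lemma swapJ t u P Q : gswap t P Q -> gswap (u * t * u^-1)%g (gpos u P) (gpos u Q).
Proof. by rewrite /gswap !conjMg conjVg; apply: is_swapJ. Qed.

Lemma swap_uniq t u P Q : gswap t P Q -> gswap u P Q -> t = u.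
Proof. by move=> tPQ uPQ; apply: (conjg_inj g); apply: is_swap_uniq uPQ. Qed.

Lemma swapD t P Q m : gswap t P Q -> gswap t (P + m * d%:Z) (Q + m * d%:Z).
Proof.
move=> [PQ tE]; split; first by rewrite !resDM.
by move=> N; rewrite !resDM tE (_ : Q + _ - _ = Q - P) //; lia.
Qed.

Lemma pos_refl i N : gpos (grefl i) N =
  if res (N + 1) == i then N + 1 else if res N == i then N - 1 else N.
Proof.
have [_ tE] := swap_refl i; rewrite /gpos tE.
rewrite res_nat res_pred res_predE (_ : _ - _ = 1) //; lia.
Qed.

Lemma swap_reflE i P : res (P + 1) = i -> gswap (grefl i) P (P + 1).
Proof.
move=> <-; have /(@swapD _ _ _ (lvl (P + 1))) := swap_refl (res (P + 1)).
by rewrite addrAC (addrC (_ : nat)%:Z) -/(mkpos _ _) mkposK addrK.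
Qed.

(** A simple reflection moves every position by at most one, so the only pairs it reverses are the
    neighbours it exchanges. *)
Lemma refl_flip i P Q : P < Q -> gpos (grefl i) Q < gpos (grefl i) P ->
  Q = P + 1 /\ res Q = i.
Proof.
move=> PQ; rewrite !pos_refl; case: (eqVneq Q (P + 1)) => [->|QP].
  by case: (eqVneq (res (P + 1)) i) => //; do 2?[case: ifP => _]; lia.
by do 4?[case: ifP => _]; lia.
Qed.

Lemma swap2 t P Q : gswap t P Q -> (t * t)%g = 1%g.
Proof. by move=> tPQ; apply: (conjg_inj g); rewrite conjMg conj1g (is_swap2 tPQ). Qed.

Lemma refl2 i : (grefl i * grefl i)%g = 1%g.
Proof. exact: swap2 (swap_refl i). Qed.

Lemma reflV i : (grefl i)^-1%g = grefl i.
Proof. by apply: (mulgI (grefl i)); rewrite mulgV refl2. Qed.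

Lemma trans_sum_refl i : trans_sum (grefl i) = 0.
Proof. by rewrite -(trans_sumJ _ g) refl_conj trans_sum_simple. Qed.

Lemma coxeter_affine w : cox w -> trans_sum w = 0.
Proof.
move=> [l _ <-]; elim: l => [|i l IH]; first by rewrite word_prod_nil trans_sum1.
by rewrite word_prod_cons trans_sumM IH trans_sum_refl.
Qed.

Definition gdescent w i := gpos w (i : nat)%:Z < gpos w ((i : nat)%:Z - 1).

Lemma descentE w N : gdescent w (res N) = (gpos w N < gpos w (N - 1)).
Proof.
have eN : N = (res N : nat)%:Z + lvl N * d%:Z by rewrite -{1}(@mkposK n N) addrC.
by rewrite {2 3}eN addrAC !posDM ltrD2r.
Qed.

Lemma ascentE w N : ~~ gdescent w (res N) = (gpos w (N - 1) < gpos w N).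
Proof.
rewrite descentE -leNgt le_eqVlt (inj_eq (@pos_inj w)).
by rewrite (_ : N - 1 == N = false) //; lia.
Qed.

Lemma no_descent w : trans_sum w = 0 -> (forall i, ~~ gdescent w i) -> w = 1%g.
Proof.
move=> w0 wi; apply: (conjg_inj g); rewrite conj1g; apply: ap_mono_eq1.
  by rewrite trans_sumJ.
by move=> N; rewrite -!/(gpos _ _) -{1}(addrK 1 N) -ascentE.
Qed.

(** An induction measure with no reference to reduced words: removing a descent pairs the larger
    value with the larger position, which lowers the sum of squared displacements. *)
Definition energy w : int := \sum_(k < d) (gpos w (k : nat)%:Z - (k : nat)%:Z) ^+ 2.

Lemma energy_refl w i : gdescent w i -> energy (w * grefl i)%g < energy w.
Proof.
move=> di; have pi := ord_pred_neq i.
(* For [i = 0] the residue [ord_pred i] is [d - 1] and not the position -1, but displacements are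
   periodic. *)
have pos_pred u : gpos u (ord_pred i : nat)%:Z - (ord_pred i : nat)%:Z =
    gpos u ((i : nat)%:Z - 1) - ((i : nat)%:Z - 1).
  have /eqP/res_eqP[m e] : res (ord_pred i : nat)%:Z = res ((i : nat)%:Z - 1).
    by rewrite res_nat res_pred.
  by rewrite e posDM; lia.
have res_predN N := res_predE N i.
move: (ord_pred i) pi pos_pred res_predN => k0 pi pos_pred res_predN.
rewrite /energy (bigD1 i) //= (bigD1 k0) //=.
rewrite [ltRHS](bigD1 i) //= [X in _ < _ + X](bigD1 k0) //=.
rewrite [X in _ + (_ + X) < _](eq_bigr (fun k : 'I_d =>
  (gpos w (k : nat)%:Z - (k : nat)%:Z) ^+ 2)); last first.
  move=> k /andP[ki kp]; rewrite posM pos_refl res_nat (negbTE ki).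
  by rewrite -res_predN res_nat (negbTE kp).
rewrite !addrA ltrD2r !pos_pred !(posM w) !pos_refl subrK res_nat eqxx.
rewrite (_ : res (_ + 1) == i = false); last first.
  by rewrite -{2}[i]res_nat; apply/negbTE/resD1_neq.
by move: di; rewrite /gdescent !expr2; nia.
Qed.

Lemma energy_ge0 w : 0 <= energy w.
Proof. by apply: sumr_ge0 => k _; apply: sqr_ge0. Qed.

Lemma energy_ind (Pr : ext_weyl d -> Prop) :
  Pr 1%g -> (forall w i, trans_sum w = 0 -> gdescent w i -> Pr (w * grefl i)%g -> Pr w) ->
  forall w, trans_sum w = 0 -> Pr w.
Proof.
move=> P1 PS w; have [k] := ubnP `|energy w|%N.
elim: k w => // k IH w wk w0.
have [[i di]|nd] := pselect (exists i, gdescent w i).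
  apply: (PS w i) => //; apply: IH.
    by have := energy_refl di; have := energy_ge0 (w * grefl i)%g; lia.
  by rewrite trans_sumM w0 trans_sum_refl.
by rewrite (no_descent w0) // => i; apply/negP => di; apply: nd; exists i.
Qed.

(** Removing descents ends at the identity, and the reflections used spell a word for [w]. *)
Lemma affine_coxeter w : trans_sum w = 0 -> cox w.
Proof.
apply: energy_ind => [|{}w i _ _ [l _ lw]]; first by exists [::] => //; apply: word_prod_nil.
exists (l ++ [:: i]) => //.
by rewrite word_prod_cat word_prod_cons word_prod_nil mulg1 lw -mulgA refl2 mulg1.
Qed.

(** Some letter of the word first reverses the images of [P] and [Q]. If [w] is the product of the
    letters to its right, that letter equals [w t w^-1], so deleting it amounts to multiplying the
    word by [t] on the right. *)
Lemma strong_exchange l t P Q : gswap t P Q -> P < Q -> gpos (wd l) Q < gpos (wd l) P ->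
  exists2 l', wd l' = (wd l * t)%g & (size l' < size l)%N.
Proof.
move=> tPQ PQ; elim: l => [|i l IH].
  by rewrite word_prod_nil !pos1; lia.
rewrite word_prod_cons !(posM (grefl i)); set w := wd l in IH *.
have [|wPQ] := ltP (gpos w Q) (gpos w P).
  by case/IH => l' l't sl' _; exists (i :: l'); rewrite // word_prod_cons l't mulgA.
have {}wPQ : gpos w P < gpos w Q.
  by rewrite lt_neqAle wPQ andbT (inj_eq (@pos_inj w)) lt_eqF.
move=> /(refl_flip wPQ) [wQ wi]; exists l => //.
have : gswap (w * t * w^-1)%g (gpos w P) (gpos w P + 1) by rewrite -wQ; apply: swapJ.
move=> /swap_uniq /(_ (swap_reflE _)) wt.
have {wt} wt : (w * t)%g = (grefl i * w)%g.
  by rewrite -(wt i) ?mulgKV // -wQ.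
by rewrite -mulgA -/w wt mulgA refl2 mul1g.
Qed.

End AffineBruhat.

(** * The Bruhat order as the order of rank functions *)

Section AffineBruhatOrder.
Context {n : nat}.
Local Notation d := n.+2.
Local Notation res := (@res n).
Variable g : ext_weyl d.
Implicit Types (w u x y t : ext_weyl d) (m N P Q p q : int) (i : 'I_d).
Local Notation refl := (grefl g).
Local Notation pos := (gpos g).
Local Notation rk := (grank g).
Local Notation swap := (gswap g).
Local Notation descent := (gdescent g).
Local Notation len := (coxeter_length refl).
Local Notation cox := (coxeter_group refl).
Local Notation le := (bruhat_le refl).

Lemma len_swap w t P Q : cox w -> swap t P Q -> P < Q -> pos w Q < pos w P ->
  (len (w * t)%g < len w)%N.
Proof.
move=> wcox tPQ PQ wQP; have [[l lw sl] _] := coxeter_lengthP wcox.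
rewrite -lw in wQP; have [l' l'w sl'] := strong_exchange tPQ PQ wQP.
rewrite lw in l'w; have [|_ lmin] := @coxeter_lengthP _ _ refl (w * t)%g.
  by exists l'.
by rewrite -sl; apply: leq_ltn_trans (lmin _ l'w) sl'.
Qed.

Lemma len_swap_gt w t P Q : cox (w * t)%g -> swap t P Q -> P < Q ->
  pos w P < pos w Q -> (len w < len (w * t)%g)%N.
Proof.
move=> wtcox tPQ PQ wPQ; have := len_swap wtcox tPQ PQ.
rewrite -mulgA (swap2 tPQ) mulg1 !(posM g w); apply.
by rewrite (is_swapL tPQ : pos t P = Q) (is_swapR tPQ : pos t Q = P).
Qed.

Lemma reflectionP t : reflection refl t -> exists P Q, swap t P Q /\ P < Q.
Proof.
move=> [w _ [i _ <-]]; have := swapJ w (swap_refl g i).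
set P := pos w _; set Q := pos w _ => tPQ.
have [PQ|] := ltP P Q; first by exists P, Q.
rewrite le_eqVlt => /predU1P[QP|QP]; last by exists Q, P; split=> //; apply: is_swapC.
by case: tPQ => /eqP; rewrite QP.
Qed.

Lemma coxM w u : cox w -> cox u -> cox (w * u)%g.
Proof.
move=> /coxeter_affine w0 /coxeter_affine u0; apply: affine_coxeter.
by rewrite trans_sumM w0 u0.
Qed.

Lemma cox_refl i : cox (refl i).
Proof. by apply: affine_coxeter; apply: trans_sum_refl. Qed.

Lemma reflection_affine t : reflection refl t -> cox t.
Proof.
move=> [w wcox [i _ <-]]; apply: affine_coxeter.
by rewrite !trans_sumM trans_sumV trans_sum_refl addr0 subrr.
Qed.

Lemma reflection_refl i : reflection refl (refl i).
Proof.
exists 1%g; first by exists [::]; rewrite ?word_prod_nil.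
by exists i => //; rewrite mul1g invg1 mulg1.
Qed.

Lemma bruhat_stepP w t : cox w -> reflection refl t ->
  bruhat_step refl w (w * t)%g <->
  (exists P Q, [/\ swap t P Q, P < Q & pos w P < pos w Q]).
Proof.
move=> wcox rt; split=> [[_ _ wwt]|[P [Q [tPQ PQ wPQ]]]].
  have [P [Q [tPQ PQ]]] := reflectionP rt; exists P, Q; split=> //.
  rewrite lt_neqAle (inj_eq (@pos_inj _ g w)) lt_eqF //= leNgt; apply/negP => wQP.
  by have := len_swap wcox tPQ PQ wQP; rewrite ltnNge (ltnW wwt).
split=> //; first by exists t.
by apply: len_swap_gt wPQ => //; apply: coxM => //; apply: reflection_affine.
Qed.

Lemma bruhat_le_rk u w q p : le u w -> rk u q p <= rk w q p.
Proof.
elim=> {u w} [u w uw|//|u v w _ uv _]; last exact: le_trans.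
have [ucox [t rt tw] _] := uw; rewrite {w}tw in uw *.
have /(bruhat_stepP ucox rt) [P [Q [tPQ PQ uPQ]]] := uw.
by rewrite /rk /grank conjMg; apply: pos_rank_swap tPQ PQ uPQ.
Qed.

Lemma bruhat_le_refl_lt w i : cox w -> ~~ descent w i -> le w (w * refl i)%g.
Proof.
move=> wcox wi; apply: rt_step; apply/(bruhat_stepP wcox (reflection_refl i)).
exists ((i : nat)%:Z - 1), (i : nat)%:Z; split; [exact: swap_refl|lia|].
by rewrite -ascentE res_nat.
Qed.

Lemma descentM w i : descent (w * refl i)%g i = ~~ descent w i.
Proof.
have := descentE g (w * refl i)%g i%:Z; rewrite res_nat => ->.
have := ascentE g w i%:Z; rewrite res_nat => ->.
rewrite !(posM g w) !pos_refl.
by rewrite subrK res_nat eqxx (negbTE (_ : res _ != i)) // -{2}[i]res_nat resD1_neq.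
Qed.

Lemma bruhat_refl_lt w i : cox w -> descent w i -> le (w * refl i)%g w.
Proof.
move=> wcox wi; rewrite -{2}[w]mulg1 -(refl2 g i) mulgA.
apply: bruhat_le_refl_lt; first by apply: coxM => //; apply: cox_refl.
by rewrite descentM wi.
Qed.

(* The lifting property: a chain of reflections from u to w is pushed through
   s_i one step at a time. *)
Lemma bruhat_lift u w i : cox u -> le u w ->
  le (u * refl i)%g w \/ le (u * refl i)%g (w * refl i)%g.
Proof.
move=> ucox /(clos_rt_rt1n _ _ _ _) uw.
elim: uw ucox => {u w} [u|u v w uv vw IH] ucox; first by right; apply: rt_refl.
have [_ [t rt tv] _] := uv; have vcox : cox v.
  by rewrite tv; apply: coxM => //; apply: reflection_affine.
have lvw : le v w by apply: clos_rt1n_rt.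
have {IH vw} vsw := IH vcox.
suff [usv|usvs] : le (u * refl i)%g v \/ le (u * refl i)%g (v * refl i)%g.
- by left; apply: rt_trans lvw.
- by case: vsw => [vsw|vsw]; [left|right]; apply: rt_trans vsw.
have [ui|ui] := boolP (descent u i).
  by left; apply: rt_trans (rt_step _ _ _ _ uv); apply: bruhat_refl_lt.
rewrite {v}tv in uv vcox lvw vsw *.
have /(bruhat_stepP ucox rt) [P [Q [tPQ PQ uPQ]]] := uv.
(* If [refl i] reverses [P] and [Q], then [t] is [refl i] and the first alternative is an equality.
   Otherwise the conjugate of [t] by [refl i] is a reflection that raises [u * refl i]. *)
have [sQP|] := ltP (pos (refl i) Q) (pos (refl i) P).
  have [QP Qi] := refl_flip PQ sQP.
  left; rewrite (swap_uniq (g := g) (u := refl i) tPQ); first exact: rt_refl.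
  by rewrite QP; apply: swap_reflE; rewrite -QP.
rewrite le_eqVlt (inj_eq (@pos_inj _ g _)) lt_eqF //= => sPQ; right.
have -> : (u * t * refl i = (u * refl i) * (refl i * t * (refl i)^-1))%g.
  by rewrite reflV !mulgA -[(u * refl i * refl i)%g]mulgA refl2 mulg1.
apply: rt_step; apply/bruhat_stepP.
- by apply: coxM => //; apply: cox_refl.
- have [v vcox' [j _ <-]] := rt; exists (refl i * v)%g.
    by apply: coxM => //; apply: cox_refl.
  by exists j; rewrite // invMg !mulgA.
- exists (pos (refl i) P), (pos (refl i) Q); split=> //; first exact: swapJ.
  by rewrite -!posM -!mulgA refl2 mulg1.
Qed.

Lemma rk_refl w i q p : res q != i -> rk (w * refl i)%g q p = rk w q p.
Proof.
move=> qi; rewrite /rk /grank conjMg refl_conj /pos_rank ew_actM.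
by rewrite alcove_fix.
Qed.

Lemma rkS w q p : rk w (q + 1) p = rk w q p + (p <= pos w q)%R%:Z.
Proof. exact: pos_rankS. Qed.

Lemma rkSr w q p : rk w q p = rk w q (p + 1) + (pos w^-1%g p < q)%R%:Z.
Proof. by rewrite /rk /pos /grank /gpos conjVg; apply: pos_rankSr. Qed.

(* Away from the columns in the class of i the ranks do not change; in such a
   column an ascent gives the least rank that the two neighbours allow. *)
Lemma rk_ascent x y x' y' i : ~~ descent x' i -> ~~ descent y' i ->
  (x' = x \/ x' = x * refl i)%g -> y' = (y * refl i)%g ->
  (forall q p, rk x q p <= rk y q p) -> forall q p, rk x' q p <= rk y' q p.
Proof.
move=> x'i y'i xx' yy' xy q p.
have off q' : res q' != i -> rk x' q' p <= rk y' q' p.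
  by move=> q'i; rewrite yy' rk_refl //; case: xx' => ->; rewrite ?rk_refl.
have [qi|/off//] := eqVneq (res q) i.
have := off (q + 1); rewrite -qi resD1_neq => /(_ isT).
have := off (q - 1); rewrite -qi -{2}(subrK 1 q) eq_sym resD1_neq => /(_ isT).
have pred w : rk w q p = rk w (q - 1) p + (p <= pos w (q - 1))%R%:Z.
  by rewrite -rkS subrK.
move: x'i y'i; rewrite -qi !ascentE !rkS !pred.
have := leP p (pos x' (q - 1)); have := leP p (pos x' q).
have := leP p (pos y' (q - 1)); have := leP p (pos y' q).
do 4![case=> ?] => /=; lia.
Qed.

Lemma rk_bruhat_le x y : trans_sum x = 0 -> trans_sum y = 0 ->
  (forall q p, rk x q p <= rk y q p) -> le x y.
Proof.
move=> x0 y0; move: y y0 x x0; apply: (energy_ind (g := g)) => [x x0 x1|y i y0 yi IH x x0 xy].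
  suff -> : x = 1%g by apply: rt_refl.
  apply: (conjg_inj g); rewrite conj1g; apply: pos_rank_eq1.
    by rewrite trans_sumJ.
  by move=> q p; have := x1 q p; rewrite /rk /grank conj1g.
have xcox := affine_coxeter g x0; have ycox := affine_coxeter g y0.
have ysy := bruhat_refl_lt ycox yi.
have ysi : ~~ descent (y * refl i)%g i by rewrite descentM negbK.
have [xi|xi] := boolP (descent x i); last first.
  apply: rt_trans ysy; apply: IH => //.
  by apply: (rk_ascent xi ysi _ _ xy) => //; left.
have xsi : ~~ descent (x * refl i)%g i by rewrite descentM negbK.
have xs0 : trans_sum (x * refl i)%g = 0 by rewrite trans_sumM x0 trans_sum_refl.
have /IH : forall q p, rk (x * refl i)%g q p <= rk (y * refl i)%g q p.
  by apply: (rk_ascent xsi ysi _ _ xy) => //; right.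
(* The induction hypothesis places [x * refl i] below [y * refl i]; lifting places [x] below
   [y * refl i] or below [y], and the former is itself below [y]. *)
move=> /(_ xs0) /(bruhat_lift i) []; first exact: affine_coxeter.
  by rewrite -mulgA refl2 mulg1 => xys; apply: rt_trans ysy.
by rewrite -!mulgA refl2 !mulg1.
Qed.

End AffineBruhatOrder.

(** Away from [G] the function [f] is convex with slopes 0 and 1. At a point outside [G], either [f]
    rises with slope 1 up to the next point of [G], where [h] cannot rise faster, or [f] is constant
    back to the previous one, since when [h] has not fallen. *)
Lemma convex_interp (G : set int) (f h : int -> int) (c e : int -> bool) :
  (forall q : int, f (q + 1) = f q + (c q)%:Z) ->
  (forall q : int, h (q + 1) = h q + (e q)%:Z) ->
  (forall q : int, ~ G q -> c (q - 1) -> c q) ->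
  (forall q : int, exists k : nat, G (q - k%:Z)) ->
  (forall q : int, exists k : nat, G (q + k%:Z)) ->
  (forall q, G q -> f q <= h q) -> forall q, f q <= h q.
Proof.
move=> fS hS cS Gdn Gup Gfh.
have up (k : nat) (q : int) : G (q + k%:Z) -> c q -> f q <= h q.
  elim: k q => [|k IH] q; first by rewrite addr0 => /Gfh.
  have [Gq|nGq] := pselect (G (q + 1)) => Gqk cq.
    by have := Gfh _ Gq; rewrite fS hS cq; case: (e q) => /=; lia.
  have : f (q + 1) <= h (q + 1).
    apply: IH; last by apply: cS; rewrite ?addrK.
    by rewrite -addrA (_ : 1 + k%:Z = k.+1%:Z) //; lia.
  by rewrite fS hS cq; case: (e q) => /=; lia.
have dn (k : nat) (q : int) : G (q - k%:Z) -> ~~ c (q - 1) -> f q <= h q.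
  elim: k q => [|k IH] q; first by rewrite subr0 => /Gfh.
  move=> Gqk cq; have : f (q - 1) <= h (q - 1).
    have [/Gfh//|nGq] := pselect (G (q - 1)).
    apply: IH; last by apply/negP => /(cS _ nGq); apply/negP.
    by rewrite -addrA -opprD (_ : 1 + k%:Z = k.+1%:Z) //; lia.
  have := fS (q - 1); have := hS (q - 1); rewrite subrK (negbTE cq) => -> ->.
  by case: (e (q - 1)) => /=; lia.
move=> q; have [/Gfh//|nGq] := pselect (G q).
have [k /up fq_up] := Gup q; have [k' /dn fq_dn] := Gdn q.
by case: (boolP (c (q - 1))) => [/(cS _ nGq)|].
Qed.

(** * The Bruhat order on double cosets of face stabilizers *)

Section DoubleCosets.
Context {n : nat}.
Local Notation d := n.+2.
Local Notation res := (@res n).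
Variables (g : ext_weyl d) (A B : set int).
Hypotheses (A0 : A !=set0) (B0 : B !=set0).
Implicit Types (w u x y z t : ext_weyl d) (m N P Q p q : int) (i : 'I_d).
Local Notation refl := (grefl g).
Local Notation pos := (gpos g).
Local Notation rk := (grank g).
Local Notation descent := (gdescent g).
Local Notation len := (coxeter_length refl).
Local Notation cox := (coxeter_group refl).

Definition vertex_fixer (X : set int) : set (ext_weyl d) :=
  fixer [set ew_act g (alcove p) | p in X].
Local Notation J := (vertex_fixer A).
Local Notation H := (vertex_fixer B).

(** Adding multiples of [d] passes to homothetic lattices: the fixer stays the same, but ranks are
    compared at all of these representatives. *)
Definition period_closure (X : set int) : set int :=
  [set q | exists2 q0, X q0 & res q = res q0].

Lemma period_closure_dn X q : X !=set0 -> exists k : nat, period_closure X (q - k%:Z).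
Proof.
move=> [q0 Xq0]; exists `|((q - q0) %% d%:Z)%Z|%N; exists q0 => //.
rewrite gez0_abs ?modz_ge0 // (_ : q - _ = q0 + ((q - q0) %/ d%:Z)%Z * d%:Z).
  by rewrite resDM.
by have := divz_eq (q - q0) d%:Z; lia.
Qed.

Lemma period_closure_up X q : X !=set0 -> exists k : nat, period_closure X (q + k%:Z).
Proof.
move=> [q0 Xq0]; exists `|((q0 - q) %% d%:Z)%Z|%N; exists q0 => //.
rewrite gez0_abs ?modz_ge0 // (_ : q + _ = q0 + (- ((q0 - q) %/ d%:Z)%Z) * d%:Z).
  by rewrite resDM.
by have := divz_eq (q0 - q) d%:Z; rewrite mulNr; lia.
Qed.

Lemma ew_actJM u w a :
  ew_act ((u * w) ^ g)%g a = ew_act (u ^ g)%g (ew_act (w ^ g)%g a).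
Proof. by rewrite conjMg ew_actM. Qed.

Lemma vertex_fixerP X w : vertex_fixer X w <-> trans_sum w = 0 /\
  forall q, period_closure X q -> ew_act (w ^ g)%g (alcove q) = alcove q.
Proof.
split=> [[w0 wX]|[w0 wX]]; split=> //.
  move=> q [q0 Xq0 /eqP/res_eqP[m ->]]; rewrite alcoveDM ew_actDc; congr (_ + _).
  rewrite conjgE !ew_actM wX ?ew_actK //; by exists q0.
move=> _ [q Xq <-]; rewrite -[in RHS](wX q); last by exists q.
by rewrite conjgE -!ew_actM !mulgA mulgV mul1g.
Qed.

Lemma vertex_fixer1 X : vertex_fixer X 1%g.
Proof.
by apply/vertex_fixerP; split=> [|q _]; rewrite ?trans_sum1 // conj1g ew_act1.
Qed.

Lemma vertex_fixerM X u w :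
  vertex_fixer X u -> vertex_fixer X w -> vertex_fixer X (u * w)%g.
Proof.
move=> /vertex_fixerP[u0 uX] /vertex_fixerP[w0 wX]; apply/vertex_fixerP.
split=> [|q Xq]; first by rewrite trans_sumM u0 w0.
by rewrite conjMg ew_actM wX ?uX.
Qed.

Lemma vertex_fixerV X u : vertex_fixer X u -> vertex_fixer X u^-1%g.
Proof.
move=> /vertex_fixerP[u0 uX]; apply/vertex_fixerP.
split=> [|q Xq]; first by rewrite trans_sumV u0 oppr0.
by rewrite conjVg -{1}(uX q Xq) ew_actK.
Qed.

Lemma vertex_fixer_refl X i :
  (forall q, X q -> res q != i) -> vertex_fixer X (refl i).
Proof.
move=> Xi; apply/vertex_fixerP; split=> [|q [q0 /Xi qi rq]].
  exact: trans_sum_refl.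
by rewrite refl_conj alcove_fix // rq.
Qed.

(** The right factor fixes the column lattice and the left factor the row lattice, so these ranks
    are invariants of the double coset. *)
Lemma rk_fixer u x z q p : J u -> H z -> period_closure B q ->
  period_closure A p -> rk (u * x * z)%g q p = rk x q p.
Proof.
move=> /vertex_fixerP[_ uA] /vertex_fixerP[_ zB] Bq Ap.
rewrite /grank /pos_rank !ew_actJM zB //.
by rewrite -{1}(uA p Ap) dist_act.
Qed.

(** The usual mark of a minimal representative modulo [H]: no right descent at a generator lying in
    [H]. *)
Definition incr_cols x := forall i, (forall q, B q -> res q != i) -> ~~ descent x i.

Lemma incr_colsP x q : incr_cols x -> ~ period_closure B q ->
  pos x (q - 1) < pos x q.
Proof.
move=> xB Bq; rewrite -ascentE; apply: xB => q0 Bq0; apply/eqP => rq.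
by apply: Bq; exists q0.
Qed.

Lemma incr_cols_rk x y p : incr_cols x ->
  (forall q, period_closure B q -> rk x q p <= rk y q p) ->
  forall q, rk x q p <= rk y q p.
Proof.
move=> xB; apply: convex_interp.
- by move=> q; apply: rkS.
- by move=> q; apply: rkS.
- by move=> q /(incr_colsP xB) /ltW xq pq; apply: le_trans xq.
- by move=> q; apply: period_closure_dn.
- by move=> q; apply: period_closure_up.
Qed.

(** In the columns of [B] the ranks of [x] and of the minimal representative of its coset agree. By
    convexity [x] is then below that representative in the Bruhat order, hence no longer than it. *)
Lemma incr_cols_len x z : trans_sum x = 0 -> incr_cols x -> H z ->
  (len x <= len (x * z)%g)%N.
Proof.
move=> x0 xB; set m := min_rep refl H x.
have [[z0 Hz0 em] min] := min_repP refl x (vertex_fixer1 B).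
move=> Hz; apply: leq_trans (min _ Hz); apply: bruhat_le_length.
apply: rk_bruhat_le => //.
  by have /vertex_fixerP[z00 _] := Hz0; rewrite em trans_sumM x0 z00.
move=> q p; move: q; apply: incr_cols_rk => // q Bq.
rewrite em /grank /pos_rank ew_actJM.
by have /vertex_fixerP[_ ->] := Hz0.
Qed.

Lemma min_rep_incr x : trans_sum x = 0 -> incr_cols (min_rep refl H x).
Proof.
move=> x0 i Bi; have [[z Hz em] min] := min_repP refl x (vertex_fixer1 B).
apply/negP => mi; have mcox : cox (min_rep refl H x).
  apply: affine_coxeter; have /vertex_fixerP[z0 _] := Hz.
  by rewrite em trans_sumM x0 z0.
have := min (z * refl i)%g; rewrite mulgA -em leqNgt => /(_ _)/negP; apply.
  by apply: vertex_fixerM => //; apply: vertex_fixer_refl.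
by apply: len_swap mcox (swap_refl g i) _ mi; lia.
Qed.

Local Notation rep := (double_coset_rep refl J H).

Lemma double_coset_repE x :
  (exists2 u, J u & rep x = min_rep refl H (u * x)%g) /\
  (forall u, J u -> (len (min_rep refl H (u * x)%g) <= len (rep x))%N).
Proof.
have [p0 Ap0] := A0; set a := ew_act g (alcove p0).
(* An element of [J] fixes the weight [a], so its translation part is determined by its permutation;
   thus [J] is finite and the lengths are bounded. *)
pose F s := len (min_rep refl H (ExtWeyl s (a - permute s a) * x)%g).
suff bound u : J u -> (len (min_rep refl H (u * x)%g) <= \max_(s : 'S_d) F s)%N.
  exact: (double_coset_repP (vertex_fixer1 A) bound).
move=>  [_ /(_ a)] ua.
suff -> : u = ExtWeyl (ew_perm u) (a - permute (ew_perm u) a).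
  by rewrite -/(F _); apply: leq_bigmax.
case: u ua => s v; rewrite /ew_act => ua; congr ExtWeyl.
by apply/eqP; rewrite eq_sym subr_eq addrC eq_sym; apply/eqP/ua; exists p0.
Qed.

(* The representative is only weakly maximal on the left: two rows of a block
   may stay in increasing order when they lie in the same block of columns. *)
Lemma double_coset_rep_rows x p q : trans_sum x = 0 -> ~ period_closure A p ->
  period_closure B q ->
  pos (rep x)^-1%g (p - 1) < q -> pos (rep x)^-1%g p < q.
Proof.
move=> x0 Ap Bq; have [[u Ju ey] max] := double_coset_repE x.
set y := rep x in ey max *; set k := pos y^-1%g (p - 1); set l := pos y^-1%g p.
move=> kq; rewrite ltNge; apply/negP => ql.
have kl : k < l by apply: lt_le_trans ql.
have [yk yl] : pos y k = p - 1 /\ pos y l = p by rewrite !posKV.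
have ux0 : trans_sum (u * x)%g = 0.
  by have /vertex_fixerP[u0 _] := Ju; rewrite trans_sumM u0 x0.
have [[z Hz em] _] := min_repP refl (u * x)%g (vertex_fixer1 B).
have yB : incr_cols y by rewrite ey; apply: min_rep_incr.
have y0 : trans_sum y = 0.
  by have /vertex_fixerP[z0 _] := Hz; rewrite ey em trans_sumM ux0 z0.
set i := res p; have Ji : J (refl i).
  by apply: vertex_fixer_refl => p0 Ap0; apply/eqP => rp; apply: Ap; exists p0.
have sy0 : trans_sum (refl i * y)%g = 0 by rewrite trans_sumM y0 trans_sum_refl.
(* Only neighbours [j - 1], [j] that are translates of [k], [l] could become reversed. Then
   [l = k + 1], and [k < q <= l] puts the class of [j] into [B], where no increase is demanded. *)
have syB : incr_cols (refl i * y)%g.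
  move=> j Bj; have := yB j Bj.
  have := ascentE g (refl i * y)%g j%:Z; have := ascentE g y j%:Z.
  rewrite !res_nat => -> ->; rewrite !(posM g (refl i)) => yj.
  rewrite lt_neqAle (inj_eq (@pos_inj _ _ _)) lt_eqF //= leNgt; apply/negP.
  move=> /(refl_flip yj) [yj1 /eqP/res_eqP [m rj]].
  have jl : j%:Z = l + m * d%:Z by apply: (@pos_inj _ g y); rewrite posDM yl.
  have jk : j%:Z - 1 = k + m * d%:Z.
    by apply: (@pos_inj _ g y); rewrite posDM yk; lia.
  have ql1 : q = l by lia.
  case: Bq => q0 Bq0 rq; have /negP := Bj _ Bq0; apply.
  by rewrite -rq ql1 -(resDM l m) -jl res_nat.
have lt_sy : (len y < len (refl i * y)%g)%N.
  have -> : (refl i * y = y * (y^-1 * refl i * y^-1^-1))%g.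
    by rewrite invgK !mulgA mulgV mul1g.
  apply: (len_swap_gt (P := k) (Q := l)); rewrite ?yk ?yl //; last by lia.
    by rewrite invgK !mulgA mulgV mul1g; apply: affine_coxeter.
  apply: swapJ; rewrite -{2}(subrK 1 p); apply: swap_reflE; by rewrite subrK.
(* The product [refl i * y] is of minimal length in its coset of [H], so the representative attached
   to [refl i * u] would be longer than [y], against maximality. *)
have := max _ (vertex_fixerM Ji Ju); rewrite leqNgt => /negP; apply.
apply: leq_trans lt_sy _; rewrite -mulgA.
have [[z' Hz' ->] _] := min_repP refl (refl i * (u * x))%g (vertex_fixer1 B).
have -> : (refl i * (u * x) * z' = refl i * y * (z^-1 * z'))%g.
  by rewrite ey em !mulgA mulgK.
by apply: incr_cols_len => //; apply: vertex_fixerM => //; apply: vertex_fixerV.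
Qed.

Theorem double_coset_leP x y : trans_sum x = 0 -> trans_sum y = 0 ->
  double_coset_le refl J H x y <->
  (forall q p, period_closure B q -> period_closure A p -> rk x q p <= rk y q p).
Proof.
move=> x0 y0.
have repE w : trans_sum w = 0 -> [/\ trans_sum (rep w) = 0, incr_cols (rep w) &
    forall q p, period_closure B q -> period_closure A p -> rk (rep w) q p = rk w q p].
  move=> w0; have [[u Ju ->] _] := double_coset_repE w.
  have uw0 : trans_sum (u * w)%g = 0.
    by have /vertex_fixerP[u0 _] := Ju; rewrite trans_sumM u0 w0.
  have [[z Hz ez] _] := min_repP refl (u * w)%g (vertex_fixer1 B).
  split; last by move=> q p Bq Ap; rewrite ez rk_fixer.
    by have /vertex_fixerP[z0 _] := Hz; rewrite ez trans_sumM uw0 z0.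
  exact: min_rep_incr.
have [rx0 xB xE] := repE x x0; have [ry0 _ yE] := repE y y0.
have yrows p q := @double_coset_rep_rows y p q y0.
rewrite /double_coset_le.
move: (rep x) (rep y) rx0 xB xE ry0 yE yrows => x' y' x'0 xB xE y'0 yE yrows.
split=> [xy q p Bq Ap|xy].
  by rewrite -(xE q p Bq Ap) -(yE q p Bq Ap); apply: bruhat_le_rk.
(* Convexity of the ranks of [x'] fills in the columns. The rows are then filled in by concavity of
   the ranks of [y']; negation exchanges the two sides and makes the latter convex. *)
apply: (rk_bruhat_le x'0 y'0) => q p; move: q; apply: (incr_cols_rk xB) => q Bq.
rewrite -lerN2; move: p; apply: (convex_interp (G := period_closure A)
  (c := fun p => pos y'^-1%g p < q) (e := fun p => pos x'^-1%g p < q)).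
- by move=> p; rewrite (rkSr _ _ _ p) opprD subrK.
- by move=> p; rewrite (rkSr _ _ _ p) opprD subrK.
- by move=> p Ap; apply: yrows.
- by move=> p; apply: period_closure_dn.
- by move=> p; apply: period_closure_up.
- move=> p Ap; rewrite lerN2 (xE q p Bq Ap) (yE q p Bq Ap).
  exact: (xy q p Bq Ap).
Qed.

End DoubleCosets.

(** * Fraction fields and lattices adapted to a basis *)

Section Fraction.
Context {A : idomainType}.
Implicit Types (c : {fraction A}).

Lemma fractionP c : exists x y : A, y != 0 /\ c = tofrac x / tofrac y.
Proof.
elim/quotW: c => x; exists (frac x).1, (frac x).2.
have x0 : (frac x).2 != 0 := denom_ratioP x; split=> //.
have d0 : tofrac (frac x).2 != 0 by rewrite tofrac_eq0.
apply: (mulIf d0); rewrite mulfVK //.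
rewrite -[LHS]/(FracField.mul _ _) !piE; apply/eqmodP.
rewrite /= FracField.equivfE !numden_Ratio ?mulr1 ?oner_eq0 ?mulf_neq0 //.
by rewrite mulrC.
Qed.

End Fraction.

Section Valuation.
Context {A : idomainType} (p : A) (p0 : p != 0) (pU : p \isn't a GRing.unit).
Local Notation K := {fraction A}.
Local Notation span := Defs.span.
Local Notation t := (tofrac p : K).
Implicit Types (c x : K) (m n : int).

Definition integral x : Prop := exists a : A, tofrac a = x.

Lemma t_neq0 : t != 0. Proof. by rewrite tofrac_eq0. Qed.

Lemma t_unit : t \is a GRing.unit. Proof. by rewrite unitfE t_neq0. Qed.

Lemma integral_tX m : integral (t ^ m) <-> 0 <= m.
Proof.
split=> [[a at_]|]; last by case: m => // k _; exists (p ^+ k); rewrite rmorphXn.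
case: m at_ => // k; rewrite NegzE => ak; case/negP: pU.
have : a * p ^+ k.+1 = 1.
  apply/eqP; rewrite -tofrac_eq rmorphM rmorphXn /= ak rmorph1 -exprnN.
  by rewrite mulVf // expf_neq0 // t_neq0.
move=> akp; suff : p ^+ k.+1 \is a GRing.unit by rewrite unitrX_pos.
by apply/unitrP; exists a; rewrite [_ * a]mulrC akp.
Qed.

Lemma integralM x y : integral x -> integral y -> integral (x * y).
Proof. by move=> [a <-] [b <-]; exists (a * b); rewrite rmorphM. Qed.

Lemma integral0 : integral 0.
Proof. by exists 0; rewrite rmorph0. Qed.

Context {d : nat}.
Implicit Types (e B : 'M[K]_d) (a b : weight d) (v : 'cV[K]_d).

Definition tdiag a : 'M[K]_d := diag_mx (\row_k t ^ a k).

Lemma tdiag_mulE a (m : nat) (M : 'M[K]_(d, m)) i j :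
  (tdiag a *m M) i j = t ^ a i * M i j.
Proof. by rewrite mul_diag_mx !mxE. Qed.

Lemma mul_tdiagE a (m : nat) (M : 'M[K]_(m, d)) i j :
  (M *m tdiag a) i j = M i j * t ^ a j.
Proof. by rewrite mul_mx_diag !mxE. Qed.

Lemma tdiagM a b : tdiag a *m tdiag b = tdiag (a + b).
Proof.
rewrite /tdiag mulmx_diag; congr diag_mx; apply/rowP => k.
by rewrite !mxE ffunE exprzDr ?t_unit.
Qed.

Lemma tdiag0 : tdiag 0 = 1%:M.
Proof. by apply/matrixP => i j; rewrite !mxE ffunE. Qed.

Lemma tdiagVK a : tdiag (- a) *m tdiag a = 1%:M.
Proof. by rewrite tdiagM addNr tdiag0. Qed.

Lemma tdiagKV a : tdiag a *m tdiag (- a) = 1%:M.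
Proof. by rewrite tdiagM subrr tdiag0. Qed.

Lemma adaptedE e a : adapted p e a = e *m tdiag (- a).
Proof. by congr (_ *m diag_mx _); apply/rowP => k; rewrite !mxE ffunE. Qed.

Lemma tdiag_unit a : tdiag a \in unitmx.
Proof. by have [] := mulmx1_unit (tdiagVK a). Qed.

Lemma adapted_unit e a : e \in unitmx -> adapted p e a \in unitmx.
Proof. by move=> eU; rewrite adaptedE unitmx_mul eU tdiag_unit. Qed.

Lemma invmx_adapted e a : e \in unitmx ->
  invmx (adapted p e a) = tdiag a *m invmx e.
Proof.
move=> eU; rewrite adaptedE; apply: (can_inj (mulKmx (adapted_unit a eU))).
rewrite adaptedE mulmxV ?unitmx_mul ?eU ?tdiag_unit //.
by rewrite mulmxA -(mulmxA e) tdiagVK mulmx1 mulmxV.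
Qed.

Definition integral_mx (m n : nat) (M : 'M[K]_(m, n)) := forall i j, integral (M i j).

Lemma integral_mxP (m n : nat) (M : 'M[K]_(m, n)) :
  integral_mx M <-> exists N : 'M[A]_(m, n), M = map_mx tofrac N.
Proof.
split=> [MI|[N ->] i j]; last by exists (N i j); rewrite mxE.
have /choice [F FE] : forall ij : 'I_m * 'I_n, exists a : A, tofrac a = M ij.1 ij.2.
  by move=> ij; apply: MI.
by exists (\matrix_(i, j) F (i, j)); apply/matrixP => i j; rewrite !mxE FE.
Qed.

Lemma integral_mulmx (m n l : nat) (M : 'M[K]_(m, n)) (N : 'M[K]_(n, l)) :
  integral_mx M -> integral_mx N -> integral_mx (M *m N).
Proof.
move=> /integral_mxP [M' ->] /integral_mxP [N' ->].
by apply/integral_mxP; exists (M' *m N'); rewrite map_mxM.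
Qed.

Lemma spanP B v : B \in unitmx -> span B v <-> integral_mx (invmx B *m v).
Proof.
move=> BU; rewrite integral_mxP; split=> [[c _ <-]|[c cE]].
  by exists c; rewrite mulKmx.
by exists c => //; rewrite -cE mulKVmx.
Qed.

Lemma lattP e a v : e \in unitmx -> latt p e a v <->
  forall k : 'I_d, integral (t ^ a k * (invmx e *m v) k 0).
Proof.
move=> eU; rewrite /latt spanP ?adapted_unit // invmx_adapted // -mulmxA.
by split=> h k; [have := h k 0|move=> j; rewrite ord1]; rewrite tdiag_mulE.
Qed.

Lemma latt_sub e a b m : e \in unitmx ->
  (scale (t ^ m) (latt p e a) `<=` latt p e b) <-> (forall k : 'I_d, a k - m <= b k).
Proof.
move=> eU; split=> [sub k|le _ [v /lattP va <-]]; last first.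
  apply/lattP => // k; rewrite -scalemxAr mxE.
  rewrite (_ : _ * _ = t ^ (b k + m - a k) * (t ^ a k * (invmx e *m v) k 0)).
    by apply: integralM; [apply/integral_tX; have := le k; lia|apply: va].
  by rewrite !mulrA -!exprzDr ?t_unit // subrK.
(* The basis vector with index [k] of the first lattice tests the inclusion in coordinate [k]. *)
have : latt p e a (e *m (t ^ (- a k) *: delta_mx k 0)).
  apply/lattP => // j; rewrite mulKmx // !mxE eqxx andbT mulrCA.
  case: eqP => [->|_]; last by rewrite !mulr0; apply: integral0.
  by rewrite mulr1 -exprzDr ?t_unit // addNr; apply/integral_tX.
move=> av; have /sub/lattP : scale (t ^ m) (latt p e a)
  (t ^ m *: (e *m (t ^ (- a k) *: delta_mx k 0))) by exists (e *m (t ^ (- a k) *: delta_mx k 0)).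
move=> /(_ eU k); rewrite -scalemxAr mulKmx // !mxE !eqxx mulr1 mulrA.
by rewrite -!exprzDr ?t_unit // => /integral_tX; lia.
Qed.

Lemma scale1 (L : set 'cV[K]_d) : scale 1 L = L.
Proof.
by apply/seteqP; split=> [_ [v Lv <-]|v Lv]; [rewrite scale1r|exists v; rewrite ?scale1r].
Qed.

Lemma latt_le e a b : e \in unitmx ->
  (latt p e a `<=` latt p e b) <-> (forall k : 'I_d, a k <= b k).
Proof.
move=> eU; rewrite -{1}[latt p e a]scale1 -(expr0z t) latt_sub //.
by split=> h k; have := h k; rewrite subr0.
Qed.

Lemma latt_inj e : e \in unitmx -> injective (latt p e).
Proof.
move=> eU a b ab; apply/ffunP => k; apply/eqP; rewrite eq_le.
by apply/andP; split; move: k; apply/(latt_le _ _ eU); rewrite ab.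
Qed.

Lemma scaleM (c c' : K) (L : set 'cV[K]_d) : scale c (scale c' L) = scale (c * c') L.
Proof.
apply/seteqP; split=> [_ [_ [v Lv <-] <-]|_ [v Lv <-]].
  by exists v; rewrite ?scalerA.
by exists (c' *: v); [exists v|rewrite scalerA].
Qed.

Lemma scale_latt e a m : e \in unitmx ->
  scale (t ^ m) (latt p e a) = latt p e (a + [ffun=> - m]).
Proof.
move=> eU; apply/seteqP; split; first by apply/latt_sub => // k; rewrite !ffunE.
move=> v /lattP va; exists (t ^ (- m) *: v); last first.
  by rewrite scalerA -exprzDr ?t_unit // subrr expr0z scale1r.
apply/lattP => // k; rewrite -scalemxAr mxE mulrA -exprzDr ?t_unit //.
by have := va eU k; rewrite !ffunE.
Qed.

Lemma latt_cap e a b : e \in unitmx ->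
  latt p e a `&` latt p e b = latt p e [ffun k => Num.min (a k) (b k)].
Proof.
move=> eU; apply/seteqP; split=> v.
  move=> [/lattP va /lattP vb]; apply/lattP => // k; rewrite ffunE.
  by case: leP => _; [apply: va|apply: vb].
move=> vab; split; apply: (_ : latt p e _ `<=` latt p e _) vab.
  by apply/latt_le => // k; rewrite ffunE ge_min lexx.
by apply/latt_le => // k; rewrite ffunE ge_min lexx orbT.
Qed.

Lemma min_exponentE e a b m : e \in unitmx ->
  (forall k : 'I_d, a k - m <= b k) -> (exists k : 'I_d, a k - m = b k) ->
  min_exponent p (latt p e a) (latt p e b) = m.
Proof.
move=> eU abm [k abk]; rewrite /min_exponent; set X := [set n : int | _].
have Xm : X m.
  split=> [|n]; first exact/latt_sub.
  by move=> /(latt_sub _ _ _ eU) /(_ k); lia.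
have [Xx Xmin] := xgetPex 0 (ex_intro _ m Xm).
apply/eqP; rewrite eq_le; apply/andP; split; first by apply: Xmin; case: Xm.
by case: Xm => _; apply.
Qed.

Lemma scale_unit (u : A) e a : e \in unitmx -> u \is a GRing.unit ->
  scale (tofrac u) (latt p e a) = latt p e a.
Proof.
move=> eU uU; apply/seteqP; split=> [_ [v /lattP va <-]|v /lattP va].
  apply/lattP => // k; rewrite -scalemxAr mxE mulrCA.
  by apply: integralM; [exists u|apply: va].
exists (tofrac u^-1 *: v); last by rewrite scalerA -rmorphM mulrV // rmorph1 scale1r.
apply/lattP => // k; rewrite -scalemxAr mxE mulrCA.
by apply: integralM; [exists u^-1|apply: va].
Qed.

End Valuation.

(** * Ranks of coordinate projections *)

Section ImageDimension.
Context {k : fieldType} {d : nat}.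
Implicit Types (M N P Q : 'M[k]_d) (S T : pred 'I_d).

Definition mx_dim M : nat := \dim (limg (linfun (mulmx M) : 'Hom('cV[k]_d, 'cV[k]_d))).

Lemma linfun_mulmxE M (v : 'cV[k]_d) : linfun (mulmx M) v = M *m v.
Proof. by rewrite lfunE. Qed.

Lemma linfun_mulmxM M N : linfun (mulmx (M *m N)) =
  (linfun (mulmx M) \o linfun (mulmx N))%VF :> 'Hom('cV[k]_d, 'cV[k]_d).
Proof. by apply/lfunP => v; rewrite comp_lfunE !linfun_mulmxE mulmxA. Qed.

Lemma mx_dimMr M N : (mx_dim (M *m N) <= mx_dim N)%N.
Proof.
rewrite /mx_dim linfun_mulmxM limg_comp.
by rewrite -[X in (_ <= X)%N](limg_ker_dim (linfun (mulmx M))) leq_addl.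
Qed.

Definition sel S : 'M[k]_d := diag_mx (\row_i (S i)%:R).

Lemma sel_mulE S (m : nat) (M : 'M[k]_(d, m)) i j : (sel S *m M) i j = (S i)%:R * M i j.
Proof. by rewrite mul_diag_mx !mxE. Qed.

Lemma mul_selE S (m : nat) (M : 'M[k]_(m, d)) i j : (M *m sel S) i j = M i j * (S j)%:R.
Proof. by rewrite mul_mx_diag !mxE. Qed.

Lemma selM S T : sel S *m sel T = sel [predI S & T].
Proof.
rewrite /sel mulmx_diag; congr diag_mx; apply/rowP => i; rewrite !mxE /=.
by rewrite -natrM mulnb.
Qed.

Lemma selD S : sel S + sel [predC S] = 1%:M.
Proof.
apply/matrixP => i j; rewrite !mxE /=; case: (i == j); rewrite ?addr0 //.
by rewrite unfold_in; case: (S i); rewrite ?addr0 ?add0r.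
Qed.

Lemma mx_dim_sel_le S : (mx_dim (sel S) <= #|S|)%N.
Proof.
have sub : (limg (linfun (mulmx (sel S)) : 'Hom('cV[k]_d, 'cV[k]_d)) <=
    \sum_(i | S i) <[delta_mx i 0%R : 'cV[k]_d]>)%VS.
  apply/subvP => _ /memv_imgP [v _ ->]; rewrite linfun_mulmxE.
  rewrite [X in X \in _]matrix_sum_delta exchange_big big_ord1.
  rewrite (bigID S) /= [X in _ + X]big1 ?addr0.
    by apply: memv_sumr => i Si; rewrite memvZ ?memv_line.
  by move=> i /negbTE Si; rewrite sel_mulE Si mul0r scale0r.
apply: leq_trans (dimvS sub) _; apply: leq_trans (dimv_leq_sum _ _ _) _.
rewrite -sum1_card; apply: leq_sum => i _.
by rewrite dim_vline leq_b1.
Qed.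

(** Complementary projections add up to the identity, so their ranks sum to at least [d], while each
    is bounded by its number of coordinates. *)
Lemma mx_dim_sel S : mx_dim (sel S) = #|S|.
Proof.
apply/eqP; rewrite eqn_leq mx_dim_sel_le /=.
have : (d <= mx_dim (sel S) + mx_dim (sel [predC S]))%N.
  have {1}<- : \dim (fullv : {vspace 'cV[k]_d}) = d.
    by rewrite dimvf dim_matrix mulr1.
  apply: leq_trans (dimv_add_leqif _ _); apply: dimvS; apply/subvP => v _.
  rewrite -[v]mul1mx -(selD S) mulmxDl memv_add // -linfun_mulmxE memv_img //;
  exact: memvf.
have leC : (mx_dim (sel [predC S]) <= #|[predC S]|)%N := mx_dim_sel_le [predC S].
have cC := cardC S; rewrite card_ord in cC.
move=> h; rewrite -(leq_add2r #|[predC S]|) cC.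
by apply: leq_trans h _; rewrite leq_add2l.
Qed.

(* P and its inverse preserve the kernel of the projection sel S, hence
   induce mutually inverse maps on its image. *)
Lemma mx_dim_flag P Q S T : Q *m P = 1%:M ->
  sel S *m P *m sel [predC S] = 0 -> sel S *m Q *m sel [predC S] = 0 ->
  mx_dim (sel S *m P *m sel T) = #|[predI S & T]|.
Proof.
move=> QP PS QS.
have cut M : sel S *m M *m sel [predC S] = 0 -> sel S *m M = sel S *m M *m sel S.
  by move=> MS; rewrite -{1}[sel S *m M]mulmx1 -(selD S) mulmxDr MS addr0.
rewrite -mx_dim_sel -selM; apply/eqP; rewrite eqn_leq; apply/andP; split.
  by rewrite (cut P PS) -mulmxA mx_dimMr.
rewrite -{1}[sel S]mulmx1 -QP mulmxA (cut Q QS) -!mulmxA.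
by rewrite mulmxA mx_dimMr.
Qed.

End ImageDimension.

(** * Reduction of lattices and of their automorphisms *)

Section Reduction.
Context {A : idomainType} (p : A) (p0 : p != 0) (pU : p \isn't a GRing.unit).
Context {kappa : fieldType} (rho : {rmorphism A -> kappa}).
Hypotheses (rhop : rho p = 0) (rho_surj : forall c, exists x, rho x = c).
Context {d : nat}.
Local Notation K := {fraction A}.
Local Notation t := (tofrac p : K).
Local Notation residue := (Defs.residue rho).
Implicit Types (e : 'M[K]_d) (a b : weight d).

Lemma residueE x : residue (tofrac x) = rho x.
Proof.
rewrite /Defs.residue; congr (rho _).
have := xgetPex 0 (ex_intro (fun c => tofrac c = tofrac x) x erefl).
by move=> /eqP; rewrite tofrac_eq => /eqP.
Qed.

Lemma residue_map_mx (m n : nat) (M : 'M[A]_(m, n)) :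
  map_mx residue (map_mx tofrac M) = map_mx rho M.
Proof. by apply/matrixP => i j; rewrite !mxE residueE. Qed.

Lemma residue_mxM (m n l : nat) (M : 'M[K]_(m, n)) (N : 'M[K]_(n, l)) :
  integral_mx M -> integral_mx N ->
  map_mx residue (M *m N) = map_mx residue M *m map_mx residue N.
Proof.
move=> /integral_mxP [M' ->] /integral_mxP [N' ->].
by rewrite -map_mxM !residue_map_mx map_mxM.
Qed.

Lemma residue_tX (m : int) : 0 <= m -> residue (t ^ m) = (m == 0)%:R.
Proof.
case: m => // n _; rewrite -exprnP -rmorphXn residueE rmorphXn /= rhop.
by rewrite expr0n.
Qed.

Lemma residue0 : residue 0 = 0.
Proof. by rewrite -(rmorph0 (tofrac : A -> K)) residueE rmorph0. Qed.

Lemma residue_tdiag a : (forall i : 'I_d, 0 <= a i) ->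
  map_mx residue (tdiag p a) = sel (fun i => a i == 0).
Proof.
move=> a0; apply/matrixP => i j; rewrite !mxE; case: eqP => [_|_].
  by rewrite !mulr1n residue_tX.
by rewrite !mulr0n residue0.
Qed.

(** The basis [e] cancels and leaves the diagonal matrix of powers [b - a + n]; modulo [p] only the
    entries with exponent zero survive. *)
Lemma linking_mapE e a b (n : int) : e \in unitmx ->
  (forall i : 'I_d, a i - n <= b i) -> (exists i : 'I_d, a i - n = b i) ->
  linking_map rho p (adapted p e a) (adapted p e b) =
  linfun (mulmx (sel (fun i => a i - n == b i))).
Proof.
move=> eU le eqn; rewrite /linking_map.
rewrite -/(latt p e a) -/(latt p e b) (min_exponentE p0 pU eU le eqn).
congr (linfun (mulmx _)); rewrite invmx_adapted // adaptedE.
rewrite -mulmxA (mulmxA (invmx e)) mulVmx // mul1mx tdiagM //.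
have -> : t ^ n *: tdiag p (b - a) = tdiag p [ffun i => b i - a i + n].
  apply/matrixP => i j; rewrite !mxE !ffunE mulrnAr -exprzDr ?t_unit //.
  by rewrite addrC.
rewrite residue_tdiag => [|i]; last by rewrite ffunE; have := le i; lia.
by congr diag_mx; apply/rowP => i; rewrite !mxE ffunE; congr (nat_of_bool _)%:R; lia.
Qed.

Lemma transform_invmx (P : 'M[K]_d) L : P \in unitmx ->
  transform P L = L -> transform (invmx P) L = L.
Proof.
move=> PU PL; rewrite -{1}PL; apply/seteqP; split=> [_ [_ [v Lv <-] <-]|v Lv].
  by rewrite mulKmx.
by exists (P *m v); [exists v|rewrite mulKmx].
Qed.

(** The conjugate is the matrix of [P] in the adapted basis of the lattice that it preserves. *)
Lemma transform_integral (P : 'M[K]_d) a :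
  transform P (latt p 1%:M a) = latt p 1%:M a ->
  integral_mx (tdiag p a *m P *m tdiag p (- a)).
Proof.
move=> Pa i j.
have : latt p 1%:M a (P *m (t ^ (- a j) *: delta_mx j 0)).
  rewrite -Pa; exists (t ^ (- a j) *: delta_mx j 0) => //.
  apply/lattP; rewrite ?unitmx1 // => l; rewrite invmx1 mul1mx !mxE andbT mulrCA.
  case: eqP => [->|_]; last by rewrite !mulr0; apply: integral0.
  by rewrite mulr1 -exprzDr ?t_unit // addNr; apply/integral_tX.
move=> /lattP; rewrite unitmx1 invmx1 mul1mx => /(_ p0 isT i).
rewrite -scalemxAr -colE mxE mxE mul_tdiagE tdiag_mulE ffunE.
by rewrite -mulrA (mulrC (P i j)).
Qed.

(* P reduces to an automorphism of L(a)/pL(a) that preserves the kernel of the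
   map to L(b)/pL(b), so the images of E and of p L(c) under that map have the
   same dimension. *)
Lemma dim_linked_image (P : 'M[K]_d) a b (c : weight d) (E : {vspace 'cV[kappa]_d}) :
  P \in unitmx ->
  transform P (latt p 1%:M a) = latt p 1%:M a ->
  transform P (latt p 1%:M b) = latt p 1%:M b ->
  (forall i : 'I_d, a i <= b i <= a i + 1) ->
  (forall i : 'I_d, a i <= c i <= a i + 1) ->
  scale t^-1 [set x | latt p 1%:M a x /\
                      reduction rho (adapted p 1%:M a) x \in E] =
    transform P (latt p 1%:M c) ->
  \dim (linfun (mulmx (sel (fun i => a i == b i))) @: E)%VS =
  #|[pred i : 'I_d | (a i == b i) && (c i == a i + 1)]|.
Proof.
move=> PU Pa Pb ab ac EP.
pose S : pred 'I_d := fun i => a i == b i; pose T : pred 'I_d := fun i => c i == a i + 1.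
pose conj (Q : 'M[K]_d) := tdiag p a *m Q *m tdiag p (- a).
(* An entry from a coordinate with [b = a + 1] to one with [b = a] is [p] times the corresponding
   entry in the basis of the second lattice, which is integral as well. *)
have conj_sel (Q : 'M[K]_d) : transform Q (latt p 1%:M b) = latt p 1%:M b ->
    sel S *m map_mx residue (conj Q) *m sel [predC S] = 0.
  move=> /transform_integral Qb; apply/matrixP => i j.
  rewrite mul_selE sel_mulE mxE [RHS]mxE /= unfold_in /S.
  have [aib|] := eqVneq (a i) (b i); last by rewrite !mul0r.
  have [|ajb] := eqVneq (a j) (b j); first by rewrite mulr0.
  have [x xE] := Qb i j.
  suff -> : conj Q i j = tofrac (p * x).
    by rewrite residueE rmorphM rhop mul0r mulr0 mul0r.
  rewrite rmorphM /= xE /conj !mul_tdiagE !tdiag_mulE aib !ffunE.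
  have -> : b j = a j + 1 by have := ab j; lia.
  rewrite mulrCA -[X in _ = _ * (X * _)]expr1z -exprzDr ?t_unit //.
  by rewrite opprD addrCA subrr addr0.
have [PaI Pa'I] : integral_mx (conj P) /\ integral_mx (conj (invmx P)).
  by split; apply: transform_integral => //; apply: transform_invmx.
have QP : map_mx residue (conj (invmx P)) *m map_mx residue (conj P) = 1%:M.
  rewrite -residue_mxM // /conj !mulmxA -(mulmxA _ (tdiag p (- a))) tdiagVK //.
  rewrite mulmx1 -(mulmxA _ (invmx P)) mulVmx // mulmx1 tdiagKV //.
  by apply/matrixP => i j; rewrite !mxE -(rmorph_nat (tofrac : A -> K)) residueE rmorph_nat.
have redE x : reduction rho (adapted p 1%:M a) x = map_mx residue (tdiag p a *m x).
  by rewrite /reduction (invmx_adapted p0 a (unitmx1 _ _)) invmx1 mulmx1.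
(* The exponents, 0 or 1, that express [p L(c)] in the basis of [L(a)]; exponent zero means
   [c = a + 1], so reduction turns them into [sel T]. *)
pose w : weight d := [ffun i => 1 + a i - c i].
have w0 i : 0 <= w i by rewrite ffunE; have := ac i; lia.
have wT : map_mx residue (tdiag p w) = sel T.
  rewrite residue_tdiag //; congr diag_mx; apply/rowP => i; rewrite !mxE ffunE /T.
  by congr (nat_of_bool _)%:R; lia.
have wI : integral_mx (tdiag p w).
  move=> i j; rewrite !mxE; case: eqP => _; last by rewrite mulr0n; apply: integral0.
  by rewrite mulr1n; apply/integral_tX.
have img (z : 'cV[A]_d) : map_mx residue (tdiag p a *m (t *: (P *m (tdiag p (- c) *m map_mx tofrac z)))) =
    map_mx residue (conj P) *m sel T *m map_mx rho z.
  have zI : integral_mx (map_mx tofrac z) by apply/integral_mxP; exists z.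
  rewrite -wT -residue_map_mx -(residue_mxM PaI wI).
  rewrite -(residue_mxM (integral_mulmx PaI wI) zI).
  congr map_mx; rewrite /conj -!mulmxA; congr (_ *m _).
  rewrite scalemxAr; congr (_ *m _); rewrite !mulmxA scalemxAl; congr (_ *m _).
  rewrite tdiagM //; apply/matrixP => i j; rewrite !mxE mulrnAr; congr (_ *+ _).
  rewrite -{1}[t]expr1z -exprzDr ?t_unit // !ffunE; congr (_ ^ _); ring.
have lc (z : 'cV[A]_d) : latt p 1%:M c (tdiag p (- c) *m map_mx tofrac z).
  apply/lattP; rewrite ?unitmx1 // => i; rewrite invmx1 mul1mx -tdiag_mulE.
  by rewrite mulmxA tdiagKV // mul1mx mxE; exists (z i 0).
(* By hypothesis the preimage of [E] is [t P L(c)], and [img] computes its reduction; both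
   inclusions lift vectors along [rho]. *)
have -> : E = limg (linfun (mulmx (map_mx residue (conj P) *m sel T))).
  apply/vspaceP => y; apply/idP/memv_imgP => [yE|[z _ ->]].
    have /choice [f fE] : forall i : 'I_d, exists x, rho x = y i 0 by [].
    pose x : 'cV[K]_d := tdiag p (- a) *m map_mx tofrac (\col_i f i).
    have yx : map_mx residue (tdiag p a *m x) = y.
      rewrite mulmxA tdiagKV // mul1mx residue_map_mx.
      by apply/colP => i; rewrite !mxE fE.
    have : scale t^-1 [set x | latt p 1%:M a x /\
        reduction rho (adapted p 1%:M a) x \in E] (t^-1 *: x).
      exists x => //; split; last by rewrite redE yx.
      apply/lattP; rewrite ?unitmx1 // => i; rewrite invmx1 mul1mx -tdiag_mulE.
      by rewrite mulmxA tdiagKV // mul1mx mxE; eexists.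
    rewrite EP => -[x' [z _ zx'] x'E].
    exists (map_mx rho z); first exact: memvf.
    rewrite linfun_mulmxE -img -yx; congr (map_mx _ (_ *m _)).
    move: zx'; rewrite adaptedE mul1mx => ->.
    by rewrite x'E scalerA mulfV ?t_neq0 // scale1r.
  have /choice [f fE] : forall i : 'I_d, exists x, rho x = z i 0 by [].
  have zf : z = map_mx rho (\col_i f i) by apply/colP => i; rewrite !mxE fE.
  rewrite linfun_mulmxE zf -img -redE.
  have : transform P (latt p 1%:M c)
     (P *m (tdiag p (- c) *m map_mx tofrac (\col_i f i))).
    by exists (tdiag p (- c) *m map_mx tofrac (\col_i f i)); first exact: lc.
  rewrite -EP => -[x [_ xE] <-].
  by rewrite scalerA mulfV ?t_neq0 // scale1r.
rewrite -limg_comp -linfun_mulmxM mulmxA -/(mx_dim _).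
by rewrite (mx_dim_flag T QP) //; apply: conj_sel => //; apply: transform_invmx.
Qed.

End Reduction.

(** * The constant term of a formal power series *)

Section PowerSeries.
Context {k : fieldType}.

Fact fps_coef0_zmod : zmod_morphism (@fps_coef0 k).
Proof. by []. Qed.

Fact fps_coef0_monoid : monoid_morphism (@fps_coef0 k).
Proof.
by split=> // f h; rewrite /fps_coef0 /= big_ord_recl big_ord0 addr0 subn0.
Qed.

HB.instance Definition _ :=
  GRing.isZmodMorphism.Build {fps k} k (@fps_coef0 k) fps_coef0_zmod.
HB.instance Definition _ :=
  GRing.isMonoidMorphism.Build {fps k} k (@fps_coef0 k) fps_coef0_monoid.

Lemma fps_coef0X : fps_coef0 (@fpsX k) = 0.
Proof. by []. Qed.

Lemma fpsX_neq0 : @fpsX k != 0.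
Proof.
apply/eqP => /(congr1 (fun f : {fps k} => f 1%N)) /= /eqP.
by rewrite oner_eq0.
Qed.

Lemma fpsX_nonunit : @fpsX k \isn't a GRing.unit.
Proof.
apply/negP => /mulVr /(congr1 (@fps_coef0 k)) /eqP.
have -> : fps_coef0 ((@fpsX k)^-1 * fpsX) = 0 by rewrite rmorphM; apply: mulr0.
by rewrite rmorph1 eq_sym oner_eq0.
Qed.

Lemma fps_coef0_surj (c : k) : exists f, fps_coef0 f = c.
Proof. by exists (FPS (fun n => if n == 0%N then c else 0)). Qed.

End PowerSeries.

(** * Homothety classes over a discrete valuation ring *)

Section Homothety.
Context {A : idomainType} (p : A) {d : nat}.
Local Notation K := {fraction A}.
Local Notation t := (tofrac p : K).
Implicit Types (e : 'M[K]_d) (a b : weight d) (L : set 'cV[K]_d).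

Lemma homothety_class_id L : homothety_class L L.
Proof. by exists 1; rewrite ?oner_eq0 ?scale1. Qed.

Lemma homothety_class_scale c L : c != 0 ->
  homothety_class (scale c L) = homothety_class L.
Proof.
move=> c0; apply/seteqP; split=> [_ [c' c'0 ->]|_ [c' c'0 ->]].
  by exists (c' * c); rewrite ?mulf_neq0 // scaleM.
by exists (c' / c); rewrite ?mulf_neq0 ?invr_eq0 // scaleM mulfVK.
Qed.

Lemma transform_scale (P : 'M[K]_d) c L : transform P (scale c L) = scale c (transform P L).
Proof.
apply/seteqP; split=> [_ [_ [v Lv <-] <-]|_ [_ [v Lv <-] <-]].
  by exists (P *m v); [exists v|rewrite scalemxAr].
by exists (c *: v); [exists v|rewrite scalemxAr].
Qed.

Hypothesis dvr : is_dvr p.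

Lemma dvr_neq0 : p != 0. Proof. by case: dvr. Qed.
Lemma dvr_nonunit : p \isn't a GRing.unit. Proof. by case: dvr. Qed.

Lemma scale_lattDc e a (m : int) : e \in unitmx ->
  scale (t ^ m) (latt p e a) = latt p e (a + [ffun=> - m]).
Proof. by move=> eU; apply: scale_latt => //; [apply: dvr_neq0|apply: dvr_nonunit]. Qed.

Lemma homothety_class_lattDc e a (m : int) : e \in unitmx ->
  homothety_class (latt p e (a + [ffun=> m])) = homothety_class (latt p e a).
Proof.
move=> eU; have tm0 : t ^ (- m) != 0 by rewrite expfz_neq0 // t_neq0 // dvr_neq0.
by rewrite -{1}[m]opprK -(scale_lattDc a (- m) eU) (homothety_class_scale _ tm0).
Qed.

(** The scaling factor is a unit times a power of the uniformizer; the unit preserves the lattice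
    and the power shifts all exponents equally. *)
Lemma homothety_class_latt e a b : e \in unitmx ->
  homothety_class (latt p e a) = homothety_class (latt p e b) ->
  exists m : int, a = b + [ffun=> m].
Proof.
move=> eU ab; have := homothety_class_id (latt p e a); rewrite ab => -[c c0 abc].
have [x [y [y0 cE]]] := fractionP c.
have x0 : x != 0 by apply: contra_neq c0 => x0; rewrite cE x0 rmorph0 mul0r.
have [_ _ dec] := dvr.
have [u [k [uU xE]]] := dec x x0; have [v [l [vU yE]]] := dec y y0.
have p0 := dvr_neq0; have pU := dvr_nonunit.
exists (- (k%:Z - l%:Z)); apply: (latt_inj p0 pU eU).
have -> : latt p e a = scale (t ^ (k%:Z - l%:Z)) (scale (tofrac (u / v)) (latt p e b)).
  rewrite abc scaleM cE xE yE !rmorphM !rmorphXn rmorphV //; congr (scale _ _).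
  rewrite invfM [RHS]mulrC mulrACA; congr (_ * _).
  by rewrite exprzDr ?t_unit // exprnN.
by rewrite (scale_unit p0 b eU) ?unitrMl ?unitrV // (scale_lattDc b _ eU).
Qed.

End Homothety.

(** * Faces of the base alcove and relative positions of their vertices *)

Section VertexSets.
Context {n : nat}.
Local Notation d := n.+2.
Implicit Types (g w : ext_weyl d) (I : {set 'I_d}).

Lemma simple_at_refl (J : Type) (g : J -> ext_weyl d) (j : J) :
  (fun i => g j * simple_reflection i * (g j)^-1)%g = grefl (g j).
Proof. by apply: funext => i; rewrite /grefl -lock. Qed.

Lemma trans_sumX w k : trans_sum (w ^+ k)%g = trans_sum w *+ k.
Proof.
elim: k => [|k IH]; first by rewrite expg0 trans_sum1.
by rewrite expgS trans_sumM IH mulrS.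
Qed.

Lemma iotaX_alcove k q : ew_act (iota_rot ^+ k)%g (alcove q) = alcove (q + k%:Z) :> weight d.
Proof.
elim: k q => [|k IH] q; first by rewrite expg0 ew_act1 addr0.
rewrite expgSr ew_actM iota_alcove IH; congr alcove; lia.
Qed.

Lemma conjgX w g k : ((g * w * g^-1) ^+ k = g * w ^+ k * g^-1)%g.
Proof.
elim: k => [|k IH]; first by rewrite !expg0 mulg1 mulgV.
by rewrite !expgS IH !mulgA mulgKV.
Qed.

Lemma fixer_omega g I :
  fixer [set ew_act g (omega i) | i in [set` I]] =
  vertex_fixer g [set (i : nat)%:Z | i in [set` I]].
Proof.
congr fixer; apply/seteqP; split=> [_ [i Ii <-]|_ [_ [i Ii <-] <-]].
  by exists (i : nat)%:Z; [exists i|rewrite omegaE].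
by exists i => //; rewrite omegaE.
Qed.

(** The rotation raises the index of a vertex of the alcove by one, so the face [F_j] has the index
    set of [tau_j] moved by [r]. *)
Lemma fixer_omega_iota g I r :
  fixer [set ew_act ((g * iota_rot * g^-1) ^+ r * g)%g (omega i) | i in [set` I]] =
  vertex_fixer g [set (i : nat)%:Z + r%:Z | i in [set` I]].
Proof.
rewrite conjgX mulgKV.
congr fixer; apply/seteqP; split=> [_ [i Ii <-]|_ [_ [i Ii <-] <-]].
  by exists ((i : nat)%:Z + r%:Z); [exists i|rewrite omegaE ew_actM iotaX_alcove].
by exists i => //; rewrite omegaE ew_actM iotaX_alcove.
Qed.

(** The factor with exponent [-r] brings the column [i + r] back to the vertex [i], which turns
    ranks into distances between [w] applied to one vertex and another vertex; of the homothety
    shifts only the difference remains. *)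
Lemma rk_shift g w r (i i' : 'I_d) (m m' : int) :
  grank g (w * (g * iota_rot * g^-1) ^- r)%g ((i : nat)%:Z + r%:Z + m * d%:Z)
    ((i' : nat)%:Z + m' * d%:Z) =
  dist (ew_act w (ew_act g (omega i)))
    (ew_act g (omega i') + cst_weight (m' - m)).
Proof.
rewrite /grank /pos_rank -(dist_act g) conjgE !ew_actM ew_actKV conjgX.
rewrite (_ : (i : nat)%:Z + r%:Z + m * d%:Z = (i : nat)%:Z + m * d%:Z + r%:Z); last by lia.
rewrite -iotaX_alcove !invgM invgK !ew_actM ew_actK ew_actK !alcoveDM !ew_actDc -!omegaE.
have -> : cst_weight m' = cst_weight (m' - m) + cst_weight m :> weight d.
  by apply/ffunP => k; rewrite !ffunE subrK.
by rewrite addrA distDc.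
Qed.

(** The vertices form a chain from [L_0] to [p^-1 L_0]: the shift is 0 when [i'] does not precede
    [i] in it, and 1 otherwise. *)
Lemma omega_near (i i' : 'I_d) : exists m : int,
  (forall k : 'I_d, omega i k <= omega i' k + m <= omega i k + 1) /\
  exists k : 'I_d, omega i k = omega i' k + m.
Proof.
have [ii'|i'i] := leqP i i'.
  exists 0; split=> [k|]; first by rewrite !ffunE; lia.
  by exists ord_max; rewrite !ffunE /=; have := ltn_ord i; have := ltn_ord i'; lia.
exists 1; split=> [k|]; first by rewrite !ffunE; lia.
by exists i'; rewrite !ffunE; lia.
Qed.

Lemma vertex_near g (i i' : 'I_d) : exists m : int,
  (forall k : 'I_d, ew_act g (omega i) k <= ew_act g (omega i') k + m
                      <= ew_act g (omega i) k + 1) /\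
  exists k : 'I_d, ew_act g (omega i) k = ew_act g (omega i') k + m.
Proof.
have [m [near [k0 eqk]]] := omega_near i i'; exists m.
split=> [k|]; last by exists (ew_perm g k0); rewrite !ew_actE eqk addrAC.
rewrite -[k](permKV (ew_perm g)) !ew_actE.
by have := near ((ew_perm g)^-1%g k); lia.
Qed.

(** Both weights take only the values [a] and [a + 1], so every term of the distance is 0 or 1. This
    links distances to the dimensions in [dim_linked_image]. *)
Lemma dist_card (a b c : weight d) :
  (forall k : 'I_d, a k <= b k <= a k + 1) ->
  (forall k : 'I_d, a k <= c k <= a k + 1) ->
  dist c b = #|[pred k : 'I_d | (a k == b k) && (c k == a k + 1)]|%:Z.
Proof.
move=> ab ac; rewrite -sum1_card big_mkcond /dist /= -[RHS]/(Posz _).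
rewrite (big_morph Posz PoszD (erefl 0%:Z)).
apply: eq_bigr => k _; have := ab k; have := ac k; rewrite inE.
by case: ifP; lia.
Qed.

(* Above the value m for which a <= b + m <= a + 1 both distances vanish, and
   below it both are determined by the size of the weights. *)
Lemma dist_all_shifts (a b c c' : weight d) (m : int) :
  (forall k : 'I_d, a k <= b k + m <= a k + 1) ->
  (forall k : 'I_d, a k <= c k <= a k + 1) ->
  (forall k : 'I_d, a k <= c' k <= a k + 1) ->
  \sum_k c k = \sum_k c' k ->
  dist c (b + cst_weight m) <= dist c' (b + cst_weight m) ->
  forall l : int, dist c (b + cst_weight l) <= dist c' (b + cst_weight l).
Proof.
move=> ab ac ac' cc' le l; have [lm|ml|->//] := ltgtP l m.
  have lo (k : 'I_d) : b k + l <= a k by have := ab k; lia.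
  rewrite !dist_ge ?cc' // => k; rewrite !ffunE; apply: le_trans (lo k) _.
    by case/andP: (ac' k).
  by case/andP: (ac k).
have hi (k : 'I_d) : a k + 1 <= b k + l by have := ab k; lia.
rewrite !dist_le0 // => k; rewrite !ffunE; apply: le_trans (hi k).
  by case/andP: (ac' k).
by case/andP: (ac k).
Qed.

End VertexSets.

(** * Ranks of linking maps on the Bruhat strata *)

Section LinkedGrassmannian.
Context {R : idomainType} (pi : R) {kappa : closedFieldType}.
Context (rho : {rmorphism R -> kappa}).
Hypotheses (hR : is_dvr pi) (hrho : is_residue_map pi rho).
Context {n : nat} (r : nat).
Local Notation d := n.+2.
Context (Gamma : set (set (set 'cV[{fraction R}]_d))).
Hypothesis hGamma : convex_configuration Gamma.
Context (e : 'M[{fraction R}]_d).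
Hypothesis he : in_apartment pi e Gamma.
Context (V : finType) (a : V -> weight d).
Hypothesis ha : represents pi e a Gamma.
Local Notation L v := (latt pi e (a v)).
Implicit Types (u v w : V) (j : max_simplex pi e a).

Let pi0 : pi != 0 := dvr_neq0 hR.
Let piU : pi \isn't a GRing.unit := dvr_nonunit hR.
Let eU : e \in unitmx. Proof. by case: he. Qed.

Let rhopi : rho pi = 0.
Proof. by apply/(proj2 hrho); exists 1; rewrite mulr1. Qed.

Lemma linkingE u v (m : int) :
  (forall i : 'I_d, a u i - m <= a v i) -> (exists i : 'I_d, a u i - m = a v i) ->
  linking pi rho e a u v = linfun (mulmx (sel (fun i => a u i - m == a v i))).
Proof. exact: linking_mapE. Qed.

Lemma min_shift_exists (b c : weight d) : exists m : int,
  (forall i : 'I_d, b i - m <= c i) /\ exists i : 'I_d, b i - m = c i.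
Proof.
have [i _ imax] := @Order.TotalTheory.arg_maxP _ int 'I_d ord0 xpredT (fun i => b i - c i) isT.
exists (b i - c i); split=> [k|]; last by exists i; lia.
by have := imax k isT; lia.
Qed.

Lemma simplex_of_pair u w : (u <> w -> adjacent pi (homothety_class (L u)) (homothety_class (L w)) /\
    adjacent pi (homothety_class (L w)) (homothety_class (L u))) ->
  exists j, u \in val j /\ w \in val j.
Proof.
move=> uw; have adj : `[< pairwise_adjacent pi e a [set u; w]%SET >].
  apply/asboolP => x y; rewrite !inE => /orP[] /eqP -> /orP[] /eqP ->; rewrite ?eqxx // => /eqP.
    by case/uw.
  by move=> /nesym /uw [].
have [t tmax sub] := @maxset_exists V (fun t => `[< pairwise_adjacent pi e a t >]) _ adj.
by exists (exist _ t tmax); rewrite !(fintype.subsetP sub) // !inE eqxx ?orbT.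
Qed.

Lemma adjacent_latt C1 C2 (b c : weight d) : C1 <> C2 ->
  C1 (latt pi e b) -> C2 (latt pi e c) ->
  (forall i : 'I_d, b i - 1 <= c i <= b i) -> adjacent pi C1 C2.
Proof.
move=> C12 C1b C2c bc; split; first exact: C12.
exists (latt pi e b), (latt pi e c); split; [exact: C1b|exact: C2c| |].
  rewrite -[tofrac pi]expr1z; apply/(latt_sub pi0 piU _ _ _ eU) => i.
  by case/andP: (bc i).
by apply/(latt_le pi0 piU _ _ eU) => i; case/andP: (bc i).
Qed.

(* Convexity provides the class of [L v] cut with p^(m-1) [L u], which is
   adjacent to [L u]; the linking maps from u to it and to v have the same
   kernel, so all ranks occur within the simplices. *)
Lemma linking_in_simplex u v : exists j w,
  [/\ u \in val j, w \in val j & linking pi rho e a u v = linking pi rho e a u w].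
Proof.
have [m [le [i0 eq0]]] := min_shift_exists (a u) (a v).
have [_ _ _ conv] := hGamma; have [inj Gim] := ha.
pose b : weight d := [ffun i => Num.min (a v i) (a u i - m + 1)].
have class v' : Gamma (homothety_class (L v')) by rewrite Gim; exists v'.
have shift_u (l : int) : homothety_class (latt pi e (a u + [ffun=> l])) = homothety_class (L u).
  exact: homothety_class_lattDc.
have [w _ wb] : [set homothety_class (L v) | v in setT] (homothety_class (latt pi e b)).
  rewrite -Gim (_ : latt pi e b = L v `&` latt pi e (a u + [ffun=> 1 - m])).
    apply: conv (class v) (class u) _ _; first exact: homothety_class_id.
    by rewrite -(shift_u (1 - m)); apply: homothety_class_id.
  rewrite latt_cap //; congr latt; apply/ffunP => i; rewrite !ffunE.
  by congr Num.min; ring.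
have [l awb] := homothety_class_latt hR eU wb.
have bE (i : 'I_d) : b i = Num.min (a v i) (a u i - m + 1) by rewrite ffunE.
have wE (i : 'I_d) : a w i = b i + l by rewrite awb !ffunE.
have [j [uj wj]] : exists j, u \in val j /\ w \in val j.
  apply: simplex_of_pair => uw.
  have neq : homothety_class (L u) <> homothety_class (L w) by move=> /inj.
  have Kb : homothety_class (L w) (latt pi e b).
    by rewrite wb; apply: homothety_class_id.
  have Ku (l' : int) : homothety_class (L u) (latt pi e (a u + [ffun=> l'])).
    by rewrite -(shift_u l'); apply: homothety_class_id.
  have uE (l' : int) (i : 'I_d) : (a u + [ffun=> l']) i = a u i + l' by rewrite !ffunE.
  split; first apply: (adjacent_latt neq (Ku (1 - m)) Kb) => i.
    by rewrite uE bE; have := le i; lia.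
  apply: (adjacent_latt (nesym neq) Kb (Ku (- m))) => i.
  by rewrite uE bE; have := le i; lia.
exists j, w; split; [exact: uj|exact: wj|].
(* The chosen representative of [w] is [b] shifted by [l], hence the exponent [m - l]. Since
   [a u - m] never exceeds [a v], it equals [b] exactly where it equals [a v]. *)
rewrite (linkingE le (ex_intro _ i0 eq0)) (@linkingE u w (m - l)).
- congr (linfun (mulmx (diag_mx _))); apply/rowP => i; rewrite !mxE wE bE.
  by congr (nat_of_bool _)%:R; have := le i; lia.
- by move=> i; rewrite wE bE; have := le i; lia.
- by exists i0; rewrite wE bE; have := le i0; lia.
Qed.

(** On the stratum, [U u] is the reduction of [t P] applied to the lattice of [h j] acting on [a u],
    with [P] preserving the lattices of both vertices. So [dim_linked_image] gives the rank as a
    number of coordinates, and [dist_card] makes it a distance. *)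
Lemma rank_vector_card j (h : max_simplex pi e a -> ext_weyl d) U u v (m : int) :
  admissible r h -> bruhat_stratum rho r h U -> u \in val j -> v \in val j ->
  (forall i : 'I_d, a u i <= a v i + m <= a u i + 1) ->
  (exists i : 'I_d, a u i = a v i + m) ->
  (rank_vector pi rho e a U (u, v))%:Z = dist (ew_act (h j) (a u)) (a v + cst_weight m).
Proof.
move=> [hadm _] [_ /(_ j) [P [Pdet Pstab] PU]] uj vj near [i0 eq0].
have [hu _] := hadm j u uj.
have hu' (i : 'I_d) : a u i <= ew_act (h j) (a u) i <= a u i + 1 by apply: hu.
have bE (i : 'I_d) : (a v + cst_weight m) i = a v i + m by rewrite !ffunE.
have near' (i : 'I_d) : a u i <= (a v + cst_weight m) i <= a u i + 1 by rewrite bE.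
rewrite (dist_card near' hu') /rank_vector /= (@linkingE u v m); last 2 first.
- by move=> i; have := near i; lia.
- by exists i0; lia.
congr Posz.
rewrite (_ : sel (fun i => a u i - m == a v i) =
             sel (fun i => a u i == (a v + cst_weight m) i)); last first.
  congr diag_mx; apply/rowP => i; rewrite !mxE bE.
  by congr (nat_of_bool _)%:R; lia.
have X0 := @fpsX_neq0 kappa; have XU := @fpsX_nonunit kappa.
have Punit : P \in unitmx by rewrite unitmxE Pdet unitr1.
have Pb : transform P (latt (@fpsX kappa) 1%:M (a v + cst_weight m)) =
    latt (@fpsX kappa) 1%:M (a v + cst_weight m).
  have -> : a v + cst_weight m = a v + [ffun=> - - m].
    by apply/ffunP => i; rewrite !ffunE opprK.
  rewrite -(scale_latt X0 XU _ _ (unitmx1 _ _)) transform_scale.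
  by congr scale; apply: (Pstab v vj).
exact: (dim_linked_image X0 XU (fps_coef0X) (@fps_coef0_surj kappa) Punit
  (Pstab u uj) Pb near' hu' (PU u uj)).
Qed.

End LinkedGrassmannian.

(** * Comparison of the two orders *)

Theorem corollary4p18
    (R : idomainType) (pi : R) (kappa : closedFieldType)
    (rho : {rmorphism R -> kappa})
    (hR : is_dvr pi) (hrho : is_residue_map pi rho)
    (d r : nat) (hr : (0 < r < d)%N)
    (Gamma : set (set (set 'cV[{fraction R}]_d)))
    (hGamma : convex_configuration Gamma)
    (e : 'M[{fraction R}]_d) (he : in_apartment pi e Gamma)
    (V : finType) (a : V -> weight d)
    (ha : represents pi e a Gamma)
    (hchain : chain_representatives pi e a)
    (g : max_simplex pi e a -> ext_weyl d)
    (I : max_simplex pi e a -> {set 'I_d})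
    (hg : standard_position g I)
    (x y : max_simplex pi e a -> ext_weyl d)
    (hx : admissible r x) (hy : admissible r y)
    (U U' : V -> {vspace 'cV[kappa]_d})
    (hU : bruhat_stratum rho r x U) (hU' : bruhat_stratum rho r y U') :
  generalized_bruhat_le r g I x y <-> rank_le pi rho e a U U'.
Proof.
(* The bounds on [r] force [d >= 2], the form in which positions are set up. *)
case: d hr Gamma hGamma e he V a ha hchain g I hg x y hx hy U U' hU hU' => [|[|n]] hr;
  [lia|lia|].
move=> Gamma hGamma e he V a ha hchain g I hg x y hx hy U U' hU hU'.
have ex_vertex (j : max_simplex pi e a) : exists v, v \in val j.
  have [v0 [s [js _ _]]] := hchain j.
  by exists v0; rewrite -js mem_head.
have vertexE (j : max_simplex pi e a) v : v \in val j ->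
    exists2 i, i \in I j & ew_act (g j) (omega i) = a v.
  move=> vj; have : simplex_weights j (a v) by exists v.
  by rewrite hg => -[i iI <-]; exists i.
have vertexV (j : max_simplex pi e a) i : i \in I j ->
    exists2 v, v \in val j & a v = ew_act (g j) (omega i).
  move=> iI; have : simplex_weights j (ew_act (g j) (omega i)) by rewrite hg; exists i.
  by case=> v vj av; exists v.
have adm_sum (h : max_simplex pi e a -> ext_weyl n.+2) j : admissible r h ->
    trans_sum (h j) = r%:Z.
  move=> [hadm _]; have [v vj] := ex_vertex j; have [_] := hadm j v vj.
  by rewrite sum_ew_act; lia.
(* Admissibility gives [h j] translation sum [r], and [iota_at] has translation sum 1, so the
   product lies in the affine Weyl group. *)
have aff (h : max_simplex pi e a -> ext_weyl n.+2) j : admissible r h ->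
    trans_sum (h j * iota_at g j ^- r)%g = 0.
  move=> /(adm_sum h j) hj; rewrite trans_sumM trans_sumV trans_sumX hj.
  rewrite /iota_at !trans_sumM trans_sumV trans_sum_iota; lia.
have near_in_simplex (j : max_simplex pi e a) u v : u \in val j -> v \in val j ->
    exists m : int, (forall k : 'I_n.+2, a u k <= a v k + m <= a u k + 1) /\
      exists k : 'I_n.+2, a u k = a v k + m.
  move=> /vertexE [i _ <-] /vertexE [i' _ <-]; exact: vertex_near.
have bruhatE (j : max_simplex pi e a) :
    double_coset_le (simple_at g j) (stab j) (face_stab r g I j)
      (x j * iota_at g j ^- r)%g (y j * iota_at g j ^- r)%g <->
    (forall u v, u \in val j -> v \in val j -> forall m : int,
       dist (ew_act (x j) (a u)) (a v + cst_weight m) <=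
       dist (ew_act (y j) (a u)) (a v + cst_weight m)).
  have -> : stab j = vertex_fixer (g j) [set (i : nat)%:Z | i in [set` I j]].
    by rewrite -fixer_omega /stab hg.
  have -> : face_stab r g I j =
      vertex_fixer (g j) [set (i : nat)%:Z + r%:Z | i in [set` I j]].
    by rewrite -fixer_omega_iota.
  rewrite /simple_at simple_at_refl.
  have [v0 /vertexE [i0 i0I _]] := ex_vertex j.
  have A0 : [set (i : nat)%:Z | i in [set` I j]] !=set0 by exists (i0 : nat)%:Z, i0.
  have B0 : [set (i : nat)%:Z + r%:Z | i in [set` I j]] !=set0.
    by exists ((i0 : nat)%:Z + r%:Z), i0.
  apply: iff_trans (double_coset_leP (g j) A0 B0 (aff x j hx) (aff y j hy)) _.
  (* Only the difference of the two homothety shifts matters, so an unshifted column against all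
     shifted rows yields every [m]. *)
  split=> [le u v /vertexE [i iI <-] /vertexE [i' i'I <-] m|le q p].
    have xE := rk_shift (g j) (x j) r i i' 0 m.
    have yE := rk_shift (g j) (y j) r i i' 0 m.
    rewrite (_ : m - 0 = m) in xE yE; last by rewrite subr0.
    rewrite -xE -yE; apply: le.
      by exists ((i : nat)%:Z + r%:Z); [exists i|rewrite resDM].
    by exists (i' : nat)%:Z; [exists i'|rewrite resDM].
  move=> [_ [i iI <-] /eqP/res_eqP[m ->]] [_ [i' i'I <-] /eqP/res_eqP[m' ->]].
  rewrite !rk_shift.
  have [u uj <-] := vertexV j i iI; have [v vj <-] := vertexV j i' i'I.
  exact: le.
split=> [gle [u v]|rle j].
  (* The vertices [u] and [v] may share no simplex, so [v] is first replaced by a [w] that shares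
     one with [u] and has the same linking map. *)
  have [j [w [uj wj uvw]]] := linking_in_simplex hR hrho hGamma he ha u v.
  have -> : rank_vector pi rho e a U (u, v) = rank_vector pi rho e a U (u, w).
    by rewrite /rank_vector /= uvw.
  have -> : rank_vector pi rho e a U' (u, v) = rank_vector pi rho e a U' (u, w).
    by rewrite /rank_vector /= uvw.
  have [m [near eqm]] := near_in_simplex j u w uj wj.
  rewrite -lez_nat.
  rewrite (rank_vector_card hR hrho he hx hU uj wj near eqm).
  rewrite (rank_vector_card hR hrho he hy hU' uj wj near eqm).
  exact: (proj1 (bruhatE j) (gle j)).
apply: (proj2 (bruhatE j)) => u v uj vj.
have [m [near eqm]] := near_in_simplex j u v uj vj.
have [[hxj _] [hyj _]] := (hx, hy).
have [xu xs] := hxj j u uj; have [yu ys] := hyj j u uj.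
(* The rank vector controls the single shift [m]; at all other shifts the distances of [x] and [y]
   agree, because admissibility fixes the sums. *)
apply: (dist_all_shifts near xu yu).
  by move: xs ys => /eqP; rewrite subr_eq => /eqP -> /eqP; rewrite subr_eq => /eqP ->.
have := rle (u, v); rewrite -lez_nat.
rewrite (rank_vector_card hR hrho he hx hU uj vj near eqm).
by rewrite (rank_vector_card hR hrho he hy hU' uj vj near eqm).
Qed.
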